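(* Let $d\ge1$, $p\in[1,+\infty)$ and let $|\cdot|$ be a norm on $\mathbb{R}^d$. (a) $N_{d,p,|\cdot|}\le c(d,|\cdot|)+1$, and $N_{d,p,|\cdot|}\le d+2$ if $|\cdot|$ is Euclidean. (b) If $N\ge c(d,|\cdot|)+1$, or $N\ge d+2$ if $|\cdot|$ is Euclidean, then $\mathcal{Q}_{N,p}$ is a distance on $\mathcal{P}_p(\mathbb{R}^d)$, and $\mathcal{Q}_{N,p}$ is topologically equivalent to the Wasserstein distance $\mathcal{W}_p$.
   Context: $\mathcal{P}_p(\mathbb{R}^d)$ is the set of Borel probability measures $\mu$ on $\mathbb{R}^d$ with $\int|\xi|^p\mu(d\xi)<+\infty$. $\mathcal{W}_p$ is the $L^p$-Wasserstein distance with respect to $|\cdot|$. For $\mu\in\mathcal{P}_p(\mathbb{R}^d)$ and $N\ge1$, $e_{N,p}(\mu,\cdot):(\mathbb{R}^d)^N\to\mathbb{R}_+$ is $e_{N,p}(\mu,(x_1,\dots,x_N))=\big[\int_{\mathbb{R}^d}\min_{1\le i\le N}|\xi-x_i|^p\,\mu(d\xi)\big]^{1/p}$, and $\mathcal{Q}_{N,p}(\mu,\nu)=\sup_{x\in(\mathbb{R}^d)^N}|e_{N,p}(\mu,x)-e_{N,p}(\nu,x)|$, which is finite since $\mathcal{Q}_{N,p}\le\mathcal{W}_p$. $N_{d,p,|\cdot|}$ is the smallest $N\in\mathbb{N}^*$ such that both of the following hold: (1) for all $\mu,\nu\in\mathcal{P}_p(\mathbb{R}^d)$, if $e_{N,p}(\mu,\cdot)=e_{N,p}(\nu,\cdot)+C$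 for some real constant $C$, then $\mu=\nu$ (and $C=0$); (2) for all $\mu_n$ ($n\ge1$), $\mu_\infty\in\mathcal{P}_p(\mathbb{R}^d)$, if $e_{N,p}(\mu_n,\cdot)\to e_{N,p}(\mu_\infty,\cdot)$ pointwise, then $\mathcal{W}_p(\mu_n,\mu_\infty)\to0$. Let $S_{|\cdot|}(0,1)$ be the unit sphere and $\bar B_{|\cdot|}(a,1)$ the closed unit ball centered at $a$. The minimal sphere covering number is $c(d,|\cdot|)=\min\{k:\exists\,\{a_1,\dots,a_k\}\subset S_{|\cdot|}(0,1)\text{ with }S_{|\cdot|}(0,1)\subset\bigcup_{i=1}^k\bar B_{|\cdot|}(a_i,1)\}<+\infty$. ''Euclidean'' means that the norm is induced by an inner product. Two distances are topologically equivalent if they induce the same topology. *)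

(* Defs.v *)
From mathcomp Require Export all_boot all_order all_algebra.
From mathcomp Require Export all_classical all_reals all_analysis.

Set Implicit Arguments.
Unset Strict Implicit.
Unset Printing Implicit Defensive.

Import Order.TTheory GRing.Theory Num.Theory.
Import numFieldNormedType.Exports.

Local Open Scope classical_set_scope.
Local Open Scope ring_scope.

Section norms.
Context {R : realType} {d : nat}.
Implicit Type nm : 'rV[R]_d -> R.

Record is_norm nm : Prop := IsNorm {
  is_norm_triangle : forall x y, nm (x + y) <= nm x + nm y ;
  is_norm_homogeneous : forall (a : R) x, nm (a *: x) = `|a| * nm x ;
  is_norm_definite : forall x, nm x = 0 -> x = 0 }.

Definition euclidean nm : Prop :=
  exists dot : {dot 'rV[R]_d for idfun}, forall x, nm x = Num.sqrt (dot x x).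

Definition sphere_covered_by nm : set nat :=
  [set k | exists a : 'I_k -> 'rV[R]_d,
     (forall i, nm (a i) = 1) /\
     (forall x, nm x = 1 -> exists i, nm (x - a i) <= 1)].

End norms.

Definition is_smallest (P : set nat) (n : nat) : Prop :=
  P n /\ forall m, P m -> (n <= m)%N.

Definition is_covering_number {R : realType} {d : nat} (nm : 'rV[R]_d -> R) :
  nat -> Prop := is_smallest (sphere_covered_by nm).

(* The topology of 'rV[R]_d is the product topology, which every norm on
   R^d induces. *)
Definition borelRd (R : realType) (d : nat) :=
  g_sigma_algebraType (@open 'rV[R]_d).

Section wasserstein_and_quantization.
Context {R : realType} {d : nat}.
Variables (nm : 'rV[R]_d -> R) (p : R).
Local Notation E := (borelRd R d).
Local Notation prob := (probability E R).

(* A [probability] is a function on all sets, constrained on measurable sets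
   only; Leibniz equality would also compare the irrelevant values. *)
Definition same_measure (mu nu : prob) : Prop :=
  forall A : set E, measurable A -> mu A = nu A.

Definition finite_moment : set prob :=
  [set mu : prob | (\int[mu]_xi (nm xi `^ p)%:E < +oo)%E].

Definition coupling (mu nu : prob) : set (probability (E * E)%type R) :=
  [set pi | forall A : set E, measurable A ->
     pi (fst @^-1` A) = mu A /\ pi (snd @^-1` A) = nu A].

Definition wasserstein (mu nu : prob) : \bar R :=
  (ereal_inf [set \int[pi]_z (nm ((z.1 : 'rV[R]_d) - (z.2 : 'rV[R]_d)) `^ p)%:E
             | pi in coupling mu nu] `^ p^-1)%E.

(* The minimum over i < N is computed in \bar R, with neutral element +oo; the
   integral is finite when N >= 1 and mu has a finite moment, so that [fine]
   is harmless. *)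
Definition quantization_error (N : nat) (mu : prob) (x : 'I_N -> 'rV[R]_d) : R :=
  fine (\int[mu]_xi
    \big[Order.min/+oo]_(i < N) (nm ((xi : 'rV[R]_d) - x i) `^ p)%:E)%E `^ p^-1.

Definition quantization_dist (N : nat) (mu nu : prob) : \bar R :=
  ereal_sup [set `|quantization_error mu x - quantization_error nu x|%:E
            | x in [set: 'I_N -> 'rV[R]_d]].

Definition error_characterizes (N : nat) : Prop :=
  forall mu nu, finite_moment mu -> finite_moment nu ->
  forall C : R,
    (forall x : 'I_N -> 'rV[R]_d,
       quantization_error mu x = quantization_error nu x + C) ->
  same_measure mu nu /\ C = 0.

Definition error_characterizes_cvg (N : nat) : Prop :=
  forall (mu_ : nat -> prob) (mu : prob),
    (forall n, finite_moment (mu_ n)) -> finite_moment mu ->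
    (forall x : 'I_N -> 'rV[R]_d,
       quantization_error (mu_ n) x @[n --> \oo] --> quantization_error mu x) ->
  wasserstein (mu_ n) mu @[n --> \oo] --> 0%E.

Definition is_characterizing_number : nat -> Prop :=
  is_smallest [set N | [/\ (1 <= N)%N, error_characterizes N
                         & error_characterizes_cvg N]].

End wasserstein_and_quantization.

(* Distances on a set X of points identified up to the equivalence eqX. *)
Section distances.
Context {R : realType} {T : Type}.
Variables (X : set T) (eqX : T -> T -> Prop).

Record is_distance (D : T -> T -> \bar R) : Prop := IsDistance {
  is_distance_fin : forall x y, X x -> X y -> D x y \is a fin_num ;
  is_distance_ge0 : forall x y, X x -> X y -> (0 <= D x y)%E ;
  is_distance_eq0 : forall x y, X x -> X y -> D x y = 0%E <-> eqX x y ;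
  is_distance_sym : forall x y, X x -> X y -> D x y = D y x ;
  is_distance_triangle : forall x y z, X x -> X y -> X z ->
    (D x z <= D x y + D y z)%E }.

Definition dist_open (D : T -> T -> \bar R) : set (set T) :=
  [set U | U `<=` X /\ forall x, U x ->
     exists2 e : R, 0 < e & forall y, X y -> (D x y < e%:E)%E -> U y].

Definition topologically_equivalent (D D' : T -> T -> \bar R) : Prop :=
  dist_open D = dist_open D'.

End distances.

(* Main.v *)
From HB Require Import structures.
Require Import Defs.
From mathcomp Require Import ring lra zify measurable_realfun.

Set Implicit Arguments.
Unset Strict Implicit.
Unset Printing Implicit Defensive.

Import Order.TTheory GRing.Theory Num.Theory.
Import numFieldNormedType.Exports.

Local Open Scope classical_set_scope.
Local Open Scope ring_scope.

(* Take a grid b_1, ..., b_m around 0 such that the Voronoi cell of 0 in {0, b_1, ..., b_m}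
   is bounded: the covering points of the unit sphere, or the vertices of a simplex for a
   Euclidean norm.  Removing the point 0 from the grid raises min_i |xi - x_i|^p by a
   function psi >= 0 which is continuous, compactly supported and positive at 0; hence the
   errors e_{N,p}(mu, .)^p determine all the integrals of psi((xi - a) / r) d mu(xi).

   Summed over the points a of a fine lattice, these bumps are almost constant (the
   oscillation is controlled by counting lattice points), so a multiple of them is almost a
   partition of unity with small supports.  If the integrals of all the bumps and the
   p-th moments converge, matching the common mass of each bump by a product measure, and
   the remaining mass by one more product measure, gives couplings of vanishing cost.  This
   avoids weak compactness and Lebesgue measure on R^d.

   For e_{N,p}(mu, .) = e_{N,p}(nu, .) + C with C >= 0, convexity of t^p turns the equality
   into an inequality between the integrals of each bump, hence between the measures of
   closed sets; as both have total mass 1, mu = nu, and then C = 0.  Finally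
   Q_{N,p} <= W_p by Minkowski's inequality, and W_p-open sets are Q_{N,p}-open because
   Q_{N,p}-convergence implies pointwise convergence of the errors, hence
   W_p-convergence. *)

(** * Norms on R^d and the covering number *)

Section norm_theory.
Context {R : realType} {d : nat} (nm : 'rV[R]_d -> R) (nm_norm : is_norm nm).

Lemma norm_0 : nm 0 = 0.
Proof. by rewrite -(scale0r 0) (is_norm_homogeneous nm_norm) normr0 mul0r. Qed.

Lemma norm_opp x : nm (- x) = nm x.
Proof. by rewrite -scaleN1r (is_norm_homogeneous nm_norm) normrN1 mul1r. Qed.

Lemma norm_sym x y : nm (x - y) = nm (y - x).
Proof. by rewrite -norm_opp opprB. Qed.

Lemma norm_ge0 x : 0 <= nm x.
Proof.
have := is_norm_triangle nm_norm x (- x).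
by rewrite subrr norm_0 norm_opp -mulr2n pmulrn_lge0.
Qed.

Lemma norm_le_split x y z : nm (x - z) <= nm (x - y) + nm (y - z).
Proof. by have := is_norm_triangle nm_norm (x - y) (y - z); rewrite addrA subrK. Qed.

Lemma norm_le_add x y : nm x <= nm (x - y) + nm y.
Proof. by have := is_norm_triangle nm_norm (x - y) y; rewrite subrK. Qed.

Lemma norm_dist_dist x y : `|nm x - nm y| <= nm (x - y).
Proof.
rewrite ler_norml; have := norm_le_add x y; have := norm_le_add y x.
by rewrite (norm_sym y) => ? ?; apply/andP; split; lra.
Qed.

Lemma ler_coord (x : 'rV[R]_d) i : `|x 0 i| <= `|x|.
Proof.
rewrite [leRHS]/Num.norm /= mx_normrE.
by apply/bigmax_geP; right; exists (0, i).
Qed.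

Lemma coord_ler (x : 'rV[R]_d) (a : R) :
  0 <= a -> (forall i, `|x 0 i| <= a) -> `|x| <= a.
Proof.
move=> a0 xa; rewrite [leLHS]/Num.norm /= mx_normrE.
by apply/bigmax_leP; split => //= -[i j] _ /=; rewrite ord1.
Qed.

Lemma norm_le_mx_norm : exists2 C : R, 0 < C & forall x, nm x <= C * `|x|.
Proof.
(* The triangle inequality over the canonical basis gives the sum; adding 1 keeps the constant
   positive. *)
exists (\sum_(i < d) nm (delta_mx 0 i) + 1).
  by rewrite ltr_wpDl// sumr_ge0// => i _; exact: norm_ge0.
move=> x; apply: (@le_trans _ _ (\sum_(i < d) nm (delta_mx 0 i) * `|x|)); last first.
  by rewrite -mulr_suml ler_wpM2r// lerDl.
rewrite {1}(row_sum_delta x).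
elim/big_ind2 : _ => [|u a v b ua vb|i _]; first by rewrite norm_0.
  by rewrite (le_trans (is_norm_triangle nm_norm _ _))// lerD.
by rewrite (is_norm_homogeneous nm_norm) mulrC ler_wpM2l ?norm_ge0// ler_coord.
Qed.

Lemma lipschitz_norm_continuous (f : 'rV[R]_d -> R) :
  (forall x y, `|f x - f y| <= nm (x - y)) -> continuous f.
Proof.
move=> fl x; have [C C0 nmC] := norm_le_mx_norm.
apply/(@cvgrPdist_le _ _ _ _ (nbhs_filter x)) => /= e e0.
have eC : 0 < e / C by rewrite divr_gt0.
apply/nbhs_ballP; exists (e / C) => // y; rewrite mx_norm_ball /ball_ /= => xy.
by rewrite (le_trans (fl _ _))// (le_trans (nmC _))// mulrC -ler_pdivlMr// ltW.
Qed.

Lemma is_norm_continuous : continuous nm.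
Proof. exact: lipschitz_norm_continuous norm_dist_dist. Qed.

(** On the compact unit sphere of the sup norm, [nm] has a minimum, positive by definiteness; its
    inverse is the constant, by homogeneity. If that sphere is empty, every vector is 0. *)
Lemma mx_norm_le_norm : exists2 C : R, 0 < C & forall x, `|x| <= C * nm x.
Proof.
have [[u u1]|] := pselect (exists u : 'rV[R]_d, `|u| = 1); last first.
  move=> noU; exists 1 => // x; have [->|x0] := eqVneq x 0.
    by rewrite normr0 norm_0 mulr0.
  exfalso; apply: noU; exists (`|x|^-1 *: x).
  by rewrite normrZ normfV normr_id mulVf// normr_eq0.
pose S := [set x : 'rV[R]_d | `|x| = 1].
have cS : compact S.
  apply: bounded_closed_compact.
    by exists 1; split => // M M1 x /= ->; exact: ltW.
  apply: (@preimage_closed _ _ (fun x : 'rV[R]_d => `|x|) [set 1]).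
    by move=> ? _; exact: norm_continuous.
  exact: closed_eq.
have [||c cS' cmin] := @EVT_min_rV R d nm S _ cS.
- by exists u.
- exact/continuous_subspaceT/is_norm_continuous.
have c0 : 0 < nm c.
  rewrite lt_neqAle norm_ge0 andbT; apply/eqP => /esym /(is_norm_definite nm_norm) c0.
  by move: cS'; rewrite c0 inE /S/= normr0 => /eqP; rewrite eq_sym oner_eq0.
exists (nm c)^-1; first by rewrite invr_gt0.
move=> x; have [->|x0] := eqVneq x 0; first by rewrite normr0 norm_0 mulr0.
have xp : 0 < `|x| by rewrite normr_gt0.
have /cmin : `|x|^-1 *: x \in S.
  by rewrite inE /S/= normrZ normfV normr_id mulVf// gt_eqF.
rewrite (is_norm_homogeneous nm_norm) normfV normr_id ler_pdivlMl//.
by rewrite mulrC ler_pdivlMl.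
Qed.

Lemma sphere_compact : compact [set x | nm x = 1].
Proof.
have [C C0 Cnm] := mx_norm_le_norm.
apply: bounded_closed_compact.
  exists C; split; first exact: num_real.
  by move=> M CM x /= x1; rewrite (le_trans (Cnm x))// x1 mulr1 ltW.
apply: (@preimage_closed _ _ nm [set 1]) => [? _|]; first exact: is_norm_continuous.
exact: closed_eq.
Qed.

(** By compactness, finitely many open unit balls centred on the sphere cover it. *)
Lemma sphere_covered : exists k, sphere_covered_by nm k.
Proof.
have := sphere_compact; rewrite compact_cover => /(_ _ [set x | nm x = 1]).
move=> /(_ (fun a => [set x | nm (x - a) < 1])) [].
- move=> a _; rewrite (_ : mkset _ = (fun x => nm (x - a)) @^-1` [set y : R | y < 1])//.
  apply: open_comp; last exact: open_lt.
  move=> x _; apply: lipschitz_norm_continuous => {}x y.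
  by rewrite (le_trans (norm_dist_dist _ _))// opprB addrA subrK.
- by move=> x x1; exists x => //=; rewrite subrr norm_0.
move=> D DS Dcov; pose s : seq 'rV[R]_d := finmap.enum_fset D.
exists (size s); exists (fun i => nth 0 s i); split.
  by move=> i; have := DS _ (mem_nth 0 (ltn_ord i)); rewrite inE.
move=> x /Dcov[a /= aD xa]; have ia : (index a s < size s)%N by rewrite index_mem.
by exists (Ordinal ia); rewrite /= nth_index// ltW.
Qed.

Lemma covering_number_exists : exists c, is_covering_number nm c.
Proof.
have exP : exists k, `[< sphere_covered_by nm k >].
  by have [k Hk] := sphere_covered; exists k; apply/asboolP.
case: (ex_minnP exP) => c /asboolP Pc cmin; exists c; split => // m Pm.
exact/cmin/asboolP.
Qed.

End norm_theory.

(** * Bounded Voronoi cells *)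

(* The Voronoi cell of 0 in the grid b with b i0 replaced by 0 lies in the open ball
   of radius rho; the duplicate of b i0 makes b, as a set, the grid without 0. *)
Definition bounded_cell {R : realType} {d : nat} (nm : 'rV[R]_d -> R)
    (N : nat) (b : 'I_N -> 'rV[R]_d) (i0 : 'I_N) (rho : R) : Prop :=
  [/\ forall i, b i != 0, exists2 j, j != i0 & b j = b i0 &
      forall x, rho <= nm x -> exists2 j, j != i0 & nm (x - b j) <= nm x].

Section bounded_cells.
Context {R : realType} {d : nat} (nm : 'rV[R]_d -> R) (nm_norm : is_norm nm).

Lemma bounded_cell_widen m N (a : 'I_m.+1 -> 'rV[R]_d) rho :
  (m.+2 <= N)%N -> (forall i, a i != 0) ->
  (forall x, rho <= nm x -> exists i, nm (x - a i) <= nm x) ->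
  exists b i0, @bounded_cell _ _ nm N b i0 rho.
Proof.
case: N => [|[|n]]//; rewrite !ltnS => mn a0 acov.
(* Indices 0 and 1 both carry [a 0], so index 1 is the required duplicate; indices 1 to m + 1 run
   through all of [a], and surplus indices fall back to [a 0] by the default of [inord]. *)
exists (fun i : 'I_n.+2 => a (inord i.-1)), ord0; split=> //.
  by exists (lift ord0 ord0) => //=; congr a; apply: val_inj; rewrite /= !inordK.
move=> x /acov[i xi]; have i1 : (i.+1 < n.+2)%N by have := ltn_ord i; lia.
by exists (Ordinal i1) => //=; rewrite inord_val.
Qed.

(** For |x| >= 1 put u = x / |x|. Then |x - u| = |x| - 1, so a covering point a_i with |u - a_i| <=
    1 satisfies |x - a_i| <= |x|. The extra index leaves room for the duplicate. *)
Lemma covered_bounded_cell c N : (1 <= d)%N -> sphere_covered_by nm c ->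
  (c + 1 <= N)%N -> exists b i0, @bounded_cell _ _ nm N b i0 1.
Proof.
move=> d1 [a [a1 acov]] cN.
have nz : exists u : 'rV[R]_d, nm u != 0.
  exists (const_mx 1); apply/eqP => /(is_norm_definite nm_norm)/rowP/(_ (Ordinal d1)).
  by rewrite !mxE => /eqP; rewrite oner_eq0.
have unit (u : 'rV[R]_d) : nm u != 0 -> nm ((nm u)^-1 *: u) = 1.
  move=> u0; rewrite (is_norm_homogeneous nm_norm) ger0_norm ?mulVf//.
  by rewrite invr_ge0 norm_ge0.
case: c a a1 acov cN => [|m] a a1 acov cN.
  (* A covering is never empty, since d >= 1 provides a unit vector. *)
  by have [u /unit /acov[[]]] := nz.
apply: (@bounded_cell_widen m _ a); first by rewrite -addn1.
  move=> i; apply/eqP => ai0; have := a1 i.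
  by rewrite ai0 norm_0// => /eqP; rewrite eq_sym oner_eq0.
move=> x x1; have x0 : nm x != 0 by rewrite gt_eqF// (lt_le_trans ltr01).
have /acov[i xi] := unit _ x0; exists i.
rewrite (le_trans (norm_le_split nm_norm _ ((nm x)^-1 *: x) _))//.
rewrite -{1}(scale1r x) -scalerBl (is_norm_homogeneous nm_norm) ger0_norm; last first.
  by rewrite subr_ge0 invf_le1// (lt_le_trans ltr01).
by rewrite mulrBl mul1r mulVf//; lra.
Qed.

(* The vertices e_1, ..., e_d and -(e_1 + ... + e_d) of a simplex around 0. *)
Lemma euclidean_bounded_cell N : (1 <= d)%N -> euclidean nm -> (d + 2 <= N)%N ->
  exists b i0 rho, 0 < rho /\ @bounded_cell _ _ nm N b i0 rho.
Proof.
move=> d1 [dot nmE] dN.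
have dot_ge0 x : 0 <= dot x x.
  have [->|x0] := eqVneq x 0; first by rewrite linear0l.
  exact/ltW/neq0_dnorm_gt0.
have dotC x y : dot x y = dot y x by have := hermC dot x y; rewrite expr0 mul1r.
have closer (x b : 'rV[R]_d) : dot b b <= 2 * dot x b -> nm (x - b) <= nm x.
  move=> h; rewrite !nmE ler_sqrt// linearBl !linearBr/= (dotC b x); lra.
pose e (i : 'I_d) : 'rV[R]_d := delta_mx 0 i.
pose a (i : 'I_d.+1) : 'rV[R]_d := if unlift ord0 i is Some j then e j else - \sum_j e j.
have coordE j : (\sum_i e i) 0 j = 1.
  rewrite summxE (bigD1 j)//= mxE !eqxx big1 ?addr0// => i ij.
  by rewrite mxE eq_sym (negbTE ij) andbF.
have a0 i : a i != 0.
  rewrite /a; case: unliftP => [j _|_].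
    apply/eqP => /rowP/(_ j); rewrite !mxE !eqxx => /eqP; by rewrite oner_eq0.
  rewrite oppr_eq0; apply/eqP => s0.
  have := coordE (Ordinal d1).
  by rewrite s0 mxE => /eqP; rewrite eq_sym oner_eq0.
(* [M] is at least half of each |a_i|^2, so a vertex with <x, a_i> >= M is at least as close to x as
   0 is. *)
pose M := (\sum_i dot (a i) (a i)) / 2.
have aM i : dot (a i) (a i) <= 2 * M.
  rewrite /M mulrC divfK// (bigD1 i)//= lerDl sumr_ge0// => j _.
have M0 : 0 < M.
  have a00 : 0 < dot (a ord0) (a ord0) by apply: neq0_dnorm_gt0; exact: a0.
  by have := aM ord0; lra.
clearbody M; have [C C0 Cnm] := mx_norm_le_norm nm_norm.
pose rho := C * d%:R * d%:R * M + 1.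
have rho0 : 0 < rho by rewrite ltr_wpDl// !mulr_ge0// ?(ltW C0) ?(ltW M0).
suff cover x : rho <= nm x -> exists i, nm (x - a i) <= nm x.
  have [|b [i0 bi0]] := @bounded_cell_widen d N a rho _ a0 cover; first by lia.
  by exists b, i0, rho.
(* If 0 is strictly closest, then <x, a_i> < M for all i and, as the vertices sum to 0, also <x,
   e_j> >= - d M. Expanding <x, x> over the coordinates of x gives |x|^2 <= C d^2 M |x|, against |x|
   >= C d^2 M + 1. *)
move=> rhox; apply: contrapT => noi.
have lt_a i : dot x (a i) < M.
  rewrite ltNge; apply/negP => Mi; apply: noi; exists i; apply: closer.
  by rewrite (le_trans (aM i))// ler_wpM2l.
have x_le j : dot x (e j) <= M.
  by have := lt_a (lift ord0 j); rewrite /a liftK => /ltW.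
have x_ge j : - (d%:R * M) <= dot x (e j).
  have := lt_a ord0; rewrite /a unlift_none linearNr linear_sumr/= (bigD1 j)//=.
  have : \sum_(i < d | i != j) dot x (e i) <= \sum_(i < d | i != j) M.
    by apply: ler_sum.
  have -> : d%:R * M = M + \sum_(i < d | i != j) M.
    by rewrite mulr_natl -[in LHS](card_ord d) -sumr_const (bigD1 j).
  lra.
have x_abs j : `|dot x (e j)| <= d%:R * M.
  rewrite ler_norml x_ge (le_trans (x_le j))//.
  by rewrite ler_peMl ?(ltW M0)// ler1n.
have dotx : dot x x <= C * nm x * (d%:R * (d%:R * M)).
  rewrite {2}(row_sum_delta x) linear_sumr/=.
  apply: (@le_trans _ _ (\sum_(j < d) C * nm x * (d%:R * M))); last first.
    by rewrite sumr_const card_ord -mulr_natr; lra.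
  apply: ler_sum => j _; rewrite linearZr_LR/=.
  apply: le_trans (ler_norm _) _; rewrite normrM ler_pM//.
  by rewrite (le_trans (ler_coord _ _)).
have nmx : 0 < nm x by exact: lt_le_trans rhox.
have : nm x * nm x <= C * nm x * (d%:R * (d%:R * M)).
  by rewrite -expr2 nmE sqr_sqrtr// -nmE.
rewrite (_ : C * _ * _ = nm x * (C * d%:R * d%:R * M)); last by ring.
by rewrite ler_pM2l//; rewrite /rho in rhox; lra.
Qed.

End bounded_cells.

(** * Sums over a fine lattice *)

Section grid.
Context {R : realType} {d : nat}.

Definition int_box (n : nat) : seq 'rV[int]_d :=
  [seq \row_i ((f i : nat)%:Z - n%:Z) | f : {ffun 'I_d -> 'I_(2 * n).+1}].

Lemma mem_int_box n k : (k \in int_box n) = [forall i, `|k 0 i| <= n%:Z].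
Proof.
apply/mapP/forallP => [[f _ ->] i|kn].
  by rewrite mxE ler_norml; case: (f i) => m /=; lia.
exists [ffun i : 'I_d => inord (absz (k 0 i + n%:Z))]; first by rewrite mem_enum.
by apply/rowP => i; have := kn i; rewrite ler_norml mxE ffunE => ?; rewrite inordK; lia.
Qed.

Lemma int_box_uniq n : uniq (int_box n).
Proof.
rewrite map_inj_uniq ?enum_uniq// => f g /rowP fg.
by apply/ffunP => i; apply: val_inj; have := fg i; rewrite !mxE /=; lia.
Qed.

Lemma size_int_box n : size (int_box n) = ((2 * n).+1 ^ d)%N.
Proof. by rewrite size_map -cardE card_ffun !card_ord. Qed.

Lemma sum_const_seq (I : Type) (r : seq I) (a : R) : \sum_(i <- r) a = (size r)%:R * a.
Proof. by rewrite big_const_seq count_predT iter_addr addr0 mulr_natl. Qed.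

Lemma ler_sum_support (I : eqType) (r s : seq I) (F : I -> R) :
  uniq r -> uniq s -> (forall i, 0 <= F i) ->
  (forall i, i \in r -> F i != 0 -> i \in s) ->
  \sum_(i <- r) F i <= \sum_(i <- s) F i.
Proof.
move=> ur us F0 rs.
rewrite (bigID (fun i => F i != 0))/= [X in _ + X]big1 => [|i]; last first.
  by rewrite negbK => /eqP.
rewrite [leRHS](bigID (fun i => (i \in r) && (F i != 0))) addr0 /=.
rewrite -[leLHS]addr0 lerD ?sumr_ge0//.
rewrite -[leLHS]big_filter -[leRHS]big_filter (perm_big [seq i <- s | (i \in r) && (F i != 0)])//.
apply: uniq_perm; rewrite ?filter_uniq// => i; rewrite !mem_filter andbC.
by have [ir|//] := boolP (i \in r); have [/(rs _ ir) ->|] := boolP (F i != 0).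
Qed.

Definition grid_point (h : R) (k : 'rV[int]_d) : 'rV[R]_d :=
  \row_i (h * (k 0 i)%:~R).

Lemma grid_pointB h k l : grid_point h (k - l) = grid_point h k - grid_point h l.
Proof. by apply/rowP => i; rewrite !mxE rmorphB mulrBr. Qed.

Lemma grid_point_le h k (n : nat) : 0 < h ->
  (`|grid_point h k| <= h * n%:R) = [forall i, `|k 0 i| <= n%:Z].
Proof.
move=> h0; have le_coord i : (`|grid_point h k 0 i| <= h * n%:R) = (`|k 0 i| <= n%:Z).
  by rewrite mxE normrM (gtr0_norm h0) ler_pM2l// -intr_norm -[n%:R]/(n%:Z%:~R) ler_int.
apply/idP/forallP => [kn i|kn].
  by rewrite -le_coord (le_trans (ler_coord _ _)).
by apply: coord_ler => [|i]; rewrite ?le_coord// mulr_ge0// ltW.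
Qed.

Variables (f : 'rV[R]_d -> R) (rho : R).
Hypotheses (f_ge0 : forall x, 0 <= f x) (f_supp : forall x, rho <= `|x| -> f x = 0).
Hypothesis f_unif : forall e, 0 < e ->
  exists2 h, 0 < h & forall x y : 'rV[R]_d, `|x - y| <= h -> `|f x - f y| <= e.

(* Reduction modulo the grid: up to boundary effects, the sum at x is the sum over a
   fixed box at the fractional part y of x / h. *)
Lemma grid_sum_reduce (h : R) (K : nat) : 0 < h -> rho + h <= h * K%:R -> forall x,
  exists2 y : 'rV[R]_d, `|y| <= h & forall L,
  \sum_(k <- int_box L) f (x - grid_point h k)
    <= \sum_(k <- int_box K) f (y - grid_point h k) /\
  (`|x| + h <= h * (L%:R - K%:R) ->
   \sum_(k <- int_box K) f (y - grid_point h k) <=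
   \sum_(k <- int_box L) f (x - grid_point h k)).
Proof.
move=> h0 hK x.
(* [l] is the integer part of x / h; subtracting it from the summation index replaces x by the
   remainder y = x - h l. *)
pose l : 'rV[int]_d := \row_i Num.floor (x 0 i / h).
have fl : `|x - grid_point h l| <= h.
  apply: coord_ler => [|i]; first exact: ltW.
  rewrite !mxE /=; set z := x 0 i / h.
  have -> : x 0 i = h * z by rewrite /z mulrC divfK// gt_eqF.
  have /andP[z1 z2] := floor_itv z.
  rewrite -mulrBr normrM gtr0_norm// ler_piMr// 1?ltW// ger0_norm ?subr_ge0//.
  by move: z2; rewrite intrD; lra.
exists (x - grid_point h l) => // L.
pose y := x - grid_point h l; rewrite -/y in fl *.
have shift k : f (x - grid_point h k) = f (y - grid_point h (k - l)).
  by rewrite grid_pointB /y; congr f; rewrite opprB addrA subrK.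
rewrite !(eq_bigr _ (fun k _ => shift k)).
rewrite -(big_map (fun k => k - l) predT (fun k => f (y - grid_point h k))).
have umap : uniq [seq k - l | k <- int_box L].
  by rewrite map_inj_uniq ?int_box_uniq//; exact: addIr.
(* Since |y| <= h and rho + h <= h K, only the indices in the box of size K contribute at y. *)
have near0 k : f (y - grid_point h k) != 0 -> k \in int_box K.
  apply: contraNT; rewrite mem_int_box -(grid_point_le _ _ h0) -ltNge => Kk.
  apply/eqP/f_supp; have := lerB_dist (grid_point h k) y.
  by rewrite distrC; lra.
split; first by apply: ler_sum_support => [//||//|k _ /near0//]; exact: int_box_uniq.
move=> xL; apply: ler_sum_support => //; first exact: int_box_uniq.
move=> k; rewrite mem_int_box -(grid_point_le _ _ h0) => kK _.
apply/mapP; exists (k + l); rewrite ?addrK//.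
rewrite mem_int_box -(grid_point_le _ _ h0).
have -> : grid_point h (k + l) = grid_point h k + (x - y).
  by rewrite /y opprB (addrC x) subrK; apply/rowP => i; rewrite !mxE intrD mulrDr.
have := ler_normD (grid_point h k) (x - y); have := ler_normB x y.
by move: xL; rewrite mulrBr; lra.
Qed.

(** Each of the (2K + 1)^d terms moves by at most e between y and 0. *)
Lemma grid_sum_oscillation (K : nat) (h e : R) :
  (forall x y : 'rV[R]_d, `|x - y| <= h -> `|f x - f y| <= e) ->
  forall y : 'rV[R]_d, `|y| <= h ->
  `|\sum_(k <- int_box K) f (y - grid_point h k) -
    \sum_(k <- int_box K) f (- grid_point h k)| <= ((2 * K).+1 ^ d)%:R * e.
Proof.
move=> fe y yh; rewrite -sumrB (le_trans (ler_norm_sum _ _ _))//.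
rewrite -size_int_box -sum_const_seq.
by apply: ler_sum => k _; apply: fe; rewrite opprK subrK.
Qed.

(** By reduction and oscillation, the sums lie within [err] of the sum [s0] at 0, and err <= (e / 3)
    s0 for a fine mesh. Dividing by s0 + 2 err puts them below (s0 + err) / (s0 + 2 err) < 1 and, on
    the ball, above 1 - 3 err / (s0 + 2 err) >= 1 - e. *)
Lemma grid_partition (f0 : 0 < f 0) (e M : R) : 0 < e ->
  exists (s : seq 'rV[R]_d) (lam kap : R), [/\ 0 < lam, kap < 1,
    forall x, lam * \sum_(a <- s) f (x - a) <= kap &
    forall x : 'rV[R]_d, `|x| <= M -> 1 - e <= lam * \sum_(a <- s) f (x - a)].
Proof.
move=> e0.
have [h1 h10 fh1] := f_unif (divr_gt0 f0 (ltr0Sn R 1)).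
(* f is at least f 0 / 2 on the ball of radius 1 / Q; P is at least rho + 1 and will be the half
   side of the summation box. *)
pose Q := (Num.truncn h1^-1).+1; pose P := (Num.truncn (`|rho| + 1)).+1.
have Q0 : (0 < Q)%N by []. have P0 : (0 < P)%N by [].
have Qh1 : Q%:R^-1 <= h1.
  rewrite -(invrK h1) lef_pV2 ?posrE ?invr_gt0// ltW//.
  by rewrite truncnS_gt.
have Prho : rho + 1 <= P%:R.
  by rewrite (le_trans _ (ltW (truncnS_gt _)))// lerD2r ler_norm.
clearbody P Q.
(* The boxes of sizes K = P Q m and m have cardinals of ratio at most (P Q)^d, whatever m is. The
   allowed oscillation [e1] can thus be fixed before the mesh. *)
pose e1 := e / 3 * (f 0 / 2) / ((P * Q) ^ d)%:R.
have PQ0 : 0 < ((P * Q) ^ d)%:R :> R by rewrite ltr0n expn_gt0 muln_gt0 P0 Q0.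
have e10 : 0 < e1 by rewrite !(divr_gt0, mulr_gt0).
have [h2 h20 fh2] := f_unif e10.
pose m := (Num.truncn h2^-1).+1.
have mh2 : m%:R^-1 <= h2.
  by rewrite -(invrK h2) lef_pV2 ?posrE ?invr_gt0// ltW// truncnS_gt.
have m0 : (0 < m)%N by []. clearbody m.
(* A mesh of this form makes h K = P and h m = 1 / Q exact. *)
pose h : R := (Q * m)%:R^-1; pose K := (P * (Q * m))%N.
have h0 : 0 < h by rewrite invr_gt0 ltr0n muln_gt0 Q0.
have hK : h * K%:R = P%:R.
  by rewrite /h /K (natrM _ P) mulrCA mulVf ?mulr1// pnatr_eq0 -lt0n muln_gt0 Q0.
have hm : h * m%:R = Q%:R^-1.
  by rewrite /h natrM invfM -mulrA mulVf ?mulr1// pnatr_eq0 -lt0n.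
have h_h2 : h <= h2.
  rewrite (le_trans _ mh2)// lef_pV2 ?posrE ?ltr0n ?muln_gt0 ?Q0//.
  by rewrite ler_nat leq_pmull.
have h_1 : h <= 1.
  by rewrite invf_le1 ?ltr0n ?muln_gt0 ?Q0// ler1n muln_gt0 Q0.
clearbody h.
pose s0 := \sum_(k <- int_box K) f (- grid_point h k).
pose err : R := ((2 * K).+1 ^ d)%:R * e1.
have err0 : 0 < err by rewrite mulr_gt0// ltr0n expn_gt0.
(* The (2m + 1)^d lattice points of norm at most 1 / Q contribute at least f 0 / 2 each to [s0]. *)
have err_s0 : err <= e / 3 * s0.
  pose s1 := \sum_(k <- int_box m) f (- grid_point h k).
  have s1_ge : ((2 * m).+1 ^ d)%:R * (f 0 / 2) <= s1.
    rewrite -size_int_box -sum_const_seq /s1 !big_seq.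
    apply: ler_sum => k; rewrite mem_int_box -(grid_point_le _ _ h0) hm => km.
    have := fh1 0 (- grid_point h k); rewrite sub0r opprK.
    move=> /(_ (le_trans km Qh1)); rewrite ler_norml => /andP[_]; lra.
  have s1_le : s1 <= s0.
    apply: ler_sum_support => // [||k]; [exact: int_box_uniq..|].
    rewrite !mem_int_box => /forallP km _; apply/forallP => i.
    by rewrite (le_trans (km i))// lez_nat /K mulnA leq_pmull// muln_gt0 P0.
  rewrite (@le_trans _ _ (e / 3 * (((2 * m).+1 ^ d)%:R * (f 0 / 2))))//; last first.
    by rewrite ler_pM2l ?divr_gt0// (le_trans s1_ge).
  rewrite /err /e1 (_ : _ * _ =
    (((2 * K).+1 ^ d)%:R / ((P * Q) ^ d)%:R) * (e / 3 * (f 0 / 2))); last by ring.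
  rewrite [leRHS](_ : _ = ((2 * m).+1 ^ d)%:R * (e / 3 * (f 0 / 2))); last by ring.
  rewrite ler_pM2r; last by rewrite !(mulr_gt0, divr_gt0).
  rewrite ler_pdivrMr// -natrM ler_nat -expnMn.
  have [d0|d0] := posnP d; first by rewrite d0.
  rewrite leq_exp2r// /K.
  have -> : ((2 * m).+1 * (P * Q) = 2 * (P * (Q * m)) + P * Q)%N by ring.
  by rewrite -addn1 leq_add2l muln_gt0 P0.
have s00 : 0 < s0.
  have e3 : 0 < e / 3 by rewrite divr_gt0.
  by rewrite -(pmulr_rgt0 _ e3); exact: lt_le_trans err_s0.
(* Large enough for the lower bound of [grid_sum_reduce] to apply to every |x| <= M. *)
pose L := (K + (Num.truncn ((`|M| + h) / h)).+1)%N.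
pose lam := (s0 + 2 * err)^-1.
have lam0 : 0 < lam by rewrite invr_gt0; lra.
exists [seq grid_point h k | k <- int_box L], lam, (lam * (s0 + err)).
have hK' : rho + h <= h * K%:R by rewrite hK; lra.
have fh x y : `|x - y| <= h -> `|f x - f y| <= e1.
  by move=> xy; rewrite fh2// (le_trans xy).
split=> //.
- by rewrite /lam mulrC ltr_pdivrMr; lra.
- move=> x; rewrite ler_pM2l// big_map.
  have [y yh /(_ L)[le_yK _]] := grid_sum_reduce h0 hK' x.
  rewrite (le_trans le_yK)//; have := grid_sum_oscillation K fh yh.
  by rewrite -/s0 -/err ler_norml => /andP[_]; lra.
- move=> x xM; rewrite big_map.
  have [y yh /(_ L)[_ ge_yK]] := grid_sum_reduce h0 hK' x.
  have {ge_yK} := ge_yK _; have := grid_sum_oscillation K fh yh.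
  rewrite -/s0 -/err ler_norml => /andP[+ _] ge_yK.
  have xL : `|x| + h <= h * (L%:R - K%:R).
    rewrite /L natrD addrAC subrr add0r mulrC -ler_pdivrMr//.
    rewrite (le_trans _ (ltW (truncnS_gt _)))//.
    rewrite ler_pM2r ?invr_gt0//.
    by rewrite lerD// (le_trans xM)// ler_norm.
  move=> osc; rewrite /lam mulrC ler_pdivlMr; last by lra.
  have := ge_yK xL; nra.
Qed.
End grid.

(** * Couplings built from matching parts *)

Section density.
Context {dT : measure_display} {T : measurableType dT} {R : realType}.
Variables (P : probability T R) (h : T -> R).
Hypotheses (mh : measurable_fun setT h) (h_ge0 : forall x, 0 <= h x).
Hypothesis h1 : (\int[P]_x (h x)%:E = 1)%E.

(** The hypotheses are arguments, so that the measure and probability instances can be attached to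
    the term itself. *)
Definition density_measure of measurable_fun setT h & (forall x, 0 <= h x)
    & (\int[P]_x (h x)%:E = 1)%E : set T -> \bar R :=
  fun A => (\int[P]_(x in A) (h x)%:E)%E.

Local Notation Q := (density_measure mh h_ge0 h1).

Let Q0 : Q set0 = 0%E. Proof. exact: integral_set0. Qed.

Let Q_ge0 A : (0 <= Q A)%E.
Proof. by apply: integral_ge0 => x _; rewrite lee_fin. Qed.

Let Q_sigma_additive : semi_sigma_additive Q.
Proof.
apply: semi_sigma_additive_nng_induced => [|x]; last by rewrite lee_fin.
exact/measurable_EFinP.
Qed.

HB.instance Definition _ :=
  isMeasure.Build _ _ _ Q Q0 Q_ge0 Q_sigma_additive.

Let Q_setT : Q setT = 1%E. Proof. exact: h1. Qed.

HB.instance Definition _ := Measure_isProbability.Build _ _ _ Q Q_setT.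

Lemma density_dominates : Q `<< P.
Proof.
apply/null_content_dominatesP => A mA PA0; rewrite /density_measure.
by apply: null_set_integral => //; exact/measurable_funTS/measurable_EFinP.
Qed.

(** The Radon-Nikodym derivative of Q has the same integrals as [h] on all measurable sets, hence
    equals it almost everywhere. *)
Lemma integral_density_measure (f : T -> \bar R) :
  (forall x, 0 <= f x)%E -> measurable_fun setT f ->
  (\int[Q]_x f x = \int[P]_x (f x * (h x)%:E))%E.
Proof.
move=> f0 mf; rewrite -(Radon_Nikodym_SigmaFinite.change_of_variables density_dominates)//.
have intRN := Radon_Nikodym_SigmaFinite.f_integrable density_dominates.
apply: ae_eq_integral => //.
- by apply: emeasurable_funM => //; exact: measurable_int intRN.
- by apply: emeasurable_funM => //; exact/measurable_EFinP.
apply: ae_eqe_mul2l; apply: integral_ae_eq => //; first exact/measurable_EFinP.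
move=> A _ mA.
by rewrite -(Radon_Nikodym_SigmaFinite.f_integral density_dominates).
Qed.

End density.

Section coupling_of_parts.
Context {dT : measure_display} {T : measurableType dT} {R : realType}.
Variables (mu nu : probability T R) (I : finType) (f g : I -> T -> R) (t : I -> R).
Hypotheses (mf : forall i, measurable_fun setT (f i)).
Hypotheses (mg : forall i, measurable_fun setT (g i)).
Hypotheses (f_ge0 : forall i x, 0 <= f i x) (g_ge0 : forall i x, 0 <= g i x).
Hypotheses (f1 : forall x, \sum_i f i x = 1) (g1 : forall x, \sum_i g i x = 1).
Hypotheses (int_f : forall i, (\int[mu]_x (f i x)%:E = (t i)%:E)%E).
Hypotheses (int_g : forall i, (\int[nu]_x (g i x)%:E = (t i)%:E)%E).
Hypothesis t0 : forall i, t i = 0 -> forall x, f i x = 0 /\ g i x = 0.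

(** The density, with respect to the product measure, of the sum over i of (f_i mu) x (g_i nu) /
    t_i: the i-th parts, of common mass t_i, are coupled independently. A null t_i has inverse 0. *)
Definition parts_density (z : T * T) : R := \sum_i (t i)^-1 * f i z.1 * g i z.2.

Lemma parts_mass_ge0 i : 0 <= t i.
Proof. by rewrite -lee_fin -int_f integral_ge0// => x _; rewrite lee_fin. Qed.

Lemma parts_density_ge0 z : 0 <= parts_density z.
Proof.
by apply: sumr_ge0 => i _; rewrite !mulr_ge0 ?f_ge0 ?g_ge0 ?invr_ge0 ?parts_mass_ge0.
Qed.

Lemma measurable_parts_density : measurable_fun setT parts_density.
Proof.
apply: measurable_sum => i; apply: measurable_funM; last exact: measurableT_comp.
by apply: measurable_funM => //; exact: measurableT_comp.
Qed.

Lemma integral_lincomb (m : probability T R) (k : I -> T -> R) (c : I -> R) :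
  (forall i, measurable_fun setT (k i)) -> (forall i x, 0 <= k i x) ->
  (forall i, (\int[m]_x (k i x)%:E = (t i)%:E)%E) -> (forall i, 0 <= c i) ->
  (\int[m]_x (\sum_i c i * k i x)%:E = (\sum_i c i * t i)%:E)%E.
Proof.
move=> mk k0 int_k c0; under eq_integral do rewrite -sumEFin.
rewrite ge0_integral_sum//=; last 2 first.
- by move=> i; apply/measurable_EFinP; exact: measurable_funM.
- by move=> i x _; rewrite lee_fin mulr_ge0.
rewrite -sumEFin; apply: eq_bigr => i _; under eq_integral do rewrite EFinM.
rewrite ge0_integralZl_EFin//; first by rewrite int_k.
- by move=> x _; rewrite lee_fin.
- exact/measurable_EFinP.
Qed.

(** Integrating out the second variable turns the i-th term into f_i, as the t_i cancel (or f_i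
    vanishes when t_i = 0), and the f_i sum to 1: the first marginal is [mu]. *)
Lemma integral_parts_fst (u : T -> R) : measurable_fun setT u -> (forall x, 0 <= u x) ->
  (\int[mu \x nu]_z (u z.1 * parts_density z)%:E = \int[mu]_x (u x)%:E)%E.
Proof.
move=> mu_ u0; rewrite fubini_tonelli1 /=; last 2 first.
- apply/measurable_EFinP/measurable_funM; last exact: measurable_parts_density.
  exact: measurableT_comp.
- by move=> z; rewrite lee_fin mulr_ge0// parts_density_ge0.
apply: eq_integral => x _; rewrite /fubini_F/= /parts_density/=.
under eq_integral.
  move=> y _; rewrite mulr_sumr; under eq_bigr do rewrite mulrA; over.
rewrite (@integral_lincomb _ g) => // [|i]; last first.
  by rewrite !mulr_ge0// invr_ge0 parts_mass_ge0.
congr EFin; rewrite -[RHS]mulr1 -(f1 x) mulr_sumr; apply: eq_bigr => i _.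
have [ti|ti] := eqVneq (t i) 0; first by rewrite (t0 ti x).1 !(mulr0, mul0r).
by rewrite -mulrA; congr (_ * _); rewrite mulrAC mulVf// mul1r.
Qed.

Lemma integral_parts_snd (u : T -> R) : measurable_fun setT u -> (forall x, 0 <= u x) ->
  (\int[mu \x nu]_z (u z.2 * parts_density z)%:E = \int[nu]_x (u x)%:E)%E.
Proof.
move=> mu_ u0; rewrite fubini_tonelli2 /=; last 2 first.
- apply/measurable_EFinP/measurable_funM; last exact: measurable_parts_density.
  exact: measurableT_comp.
- by move=> z; rewrite lee_fin mulr_ge0// parts_density_ge0.
apply: eq_integral => y _; rewrite /fubini_G/= /parts_density/=.
under eq_integral.
  move=> x _; rewrite mulr_sumr; under eq_bigr do rewrite mulrAC mulrA; over.
rewrite (@integral_lincomb _ f) => // [|i]; last first.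
  by rewrite !mulr_ge0// invr_ge0 parts_mass_ge0.
congr EFin; rewrite -[RHS]mulr1 -(g1 y) mulr_sumr; apply: eq_bigr => i _.
have [ti|ti] := eqVneq (t i) 0; first by rewrite (t0 ti y).2 !(mulr0, mul0r).
by rewrite -mulrA; congr (_ * _); rewrite mulrAC mulVf// mul1r.
Qed.

Lemma coupling_of_parts : exists pi : probability (T * T)%type R,
  (forall A, measurable A -> pi (fst @^-1` A) = mu A /\ pi (snd @^-1` A) = nu A) /\
  forall c : T * T -> \bar R, (forall z, 0 <= c z)%E -> measurable_fun setT c ->
    (\int[pi]_z c z = \int[mu \x nu]_z (c z * (parts_density z)%:E))%E.
Proof.
have h1 : (\int[(mu \x nu)%E]_z (parts_density z)%:E = 1)%E.
  transitivity (\int[mu \x nu]_z (cst 1 z.1 * parts_density z)%:E)%E.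
    by apply: eq_integral => z _; rewrite mul1r.
  by rewrite integral_parts_fst//= integral_cst//= mul1e probability_setT.
exists (density_measure measurable_parts_density parts_density_ge0 h1); split.
  move=> A mA.
  have integral_indicM (D : set (T * T)) : measurable D ->
      density_measure measurable_parts_density parts_density_ge0 h1 D =
      (\int[mu \x nu]_z (\1_D z * parts_density z)%:E)%E.
    move=> mD; rewrite /density_measure integral_mkcond; apply: eq_integral => z _.
    by rewrite patchE indicE; case: ifP => _; rewrite ?mul1r ?mul0r.
  have mfst : measurable (@fst T T @^-1` A).
    by rewrite -[X in measurable X]setTI; exact: measurable_fst.
  have msnd : measurable (@snd T T @^-1` A).
    by rewrite -[X in measurable X]setTI; exact: measurable_snd.
  split.
    rewrite [LHS](integral_indicM _ mfst) (integral_parts_fst (u := \1_A))//.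
    by rewrite integral_indic// setIT.
  rewrite [LHS](integral_indicM _ msnd) (integral_parts_snd (u := \1_A))//.
  by rewrite integral_indic// setIT.
by move=> c c0 mc; exact: integral_density_measure.
Qed.

End coupling_of_parts.

(** * Powers and Borel measurability *)

Section powR_lemmas.
Context {R : realType} (p : R) (p1 : 1 <= p).

Let p0 : 0 < p. Proof. exact: lt_le_trans p1. Qed.

Lemma powR_mono (a b : R) : 0 <= a -> a <= b -> a `^ p <= b `^ p.
Proof.
by move=> a0 ab; rewrite ge0_ler_powR ?nnegrE// ?(ltW p0)// (le_trans a0).
Qed.

Lemma powRK (a : R) : 0 <= a -> (a `^ p) `^ p^-1 = a.
Proof. by move=> a0; rewrite -powRrM mulfV ?gt_eqF// powRr1. Qed.

Lemma powRVK (a : R) : 0 <= a -> (a `^ p^-1) `^ p = a.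
Proof. by move=> a0; rewrite -powRrM mulVf ?gt_eqF// powRr1. Qed.

(** The sum is at most twice the larger term. *)
Lemma powRD_le (a b : R) : 0 <= a -> 0 <= b ->
  (a + b) `^ p <= 2 `^ p * (a `^ p + b `^ p).
Proof.
move=> a0 b0; wlog ab : a b a0 b0 / a <= b.
  move=> H; have [ab|/ltW ba] := leP a b; first exact: H.
  by rewrite addrC [X in _ * X]addrC; exact: H.
apply: (@le_trans _ _ ((2 * b) `^ p)).
  by apply: powR_mono; [exact: addr_ge0|lra].
by rewrite powRM// ler_wpM2l ?powR_ge0// lerDr powR_ge0.
Qed.

Lemma powR_convex (w x y : R) : 0 <= w -> w <= 1 -> 0 <= x -> 0 <= y ->
  (w * x + (1 - w) * y) `^ p <= w * x `^ p + (1 - w) * y `^ p.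
Proof.
move=> w0 w1 x0 y0.
have := convex_powR p1 (Itv01 w0 w1) (x := x) (y := y).
by rewrite !inE/= !in_itv/= !andbT !convRE/=; exact.
Qed.

(* Three-slope inequality at s, t, t + 1. *)
Lemma powR_lipschitz (s t B : R) : 0 <= s -> s <= t -> t <= B ->
  t `^ p - s `^ p <= (t - s) * (B + 1) `^ p.
Proof.
move=> s0 st tB; pose h := t - s; have h0 : 0 <= h by rewrite subr_ge0.
have h1 : 0 < 1 + h by rewrite ltr_pwDl.
have w1 : (1 + h)^-1 <= 1 by rewrite invf_le1// lerDl.
have w0 : 0 <= (1 + h)^-1 by rewrite invr_ge0 ltW.
have t0 : 0 <= t + 1 by lra.
(* With h = t - s, the point t is the mean of s and t + 1 with weights 1 / (1 + h) and h / (1 +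
   h). *)
have := powR_convex w0 w1 s0 t0.
have -> : (1 + h)^-1 * s + (1 - (1 + h)^-1) * (t + 1) = t.
  by rewrite /h; field; rewrite -/h gt_eqF.
rewrite -(ler_pM2l h1) mulrDr !mulrA mulfV ?gt_eqF// mul1r mulrBr mulr1 mulfV ?gt_eqF//.
have -> : 1 + h - 1 = h by lra.
have : (t + 1) `^ p <= (B + 1) `^ p by apply: powR_mono; lra.
have := powR_ge0 t p; rewrite -/h; nra.
Qed.

(** v and u + C are complementary convex combinations of u and v + C, so the sum of their powers is
    at most that of u and v + C. In the degenerate case v + C = u, both differences are 0. *)
Lemma powR_convex_shift (u v C : R) : 0 <= u -> u <= v -> 0 <= C ->
  v `^ p - u `^ p <= (v + C) `^ p - (u + C) `^ p.
Proof.
move=> u0 uv C0; have [D0|D0] := eqVneq (v + C - u) 0.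
  have -> : v = u by lra.
  by rewrite !subrr.
have Dp : 0 < v + C - u by rewrite lt_neqAle eq_sym D0/=; lra.
pose w := C / (v + C - u).
have w0 : 0 <= w by rewrite divr_ge0// ltW.
have w1 : w <= 1 by rewrite ler_pdivrMr//; lra.
have vC0 : 0 <= v + C by lra.
have w1' : 1 - w <= 1 by lra.
have w0' : 0 <= 1 - w by lra.
have := powR_convex w0 w1 u0 vC0; have := powR_convex w0' w1' u0 vC0.
have -> : w * u + (1 - w) * (v + C) = v by rewrite /w; field.
have -> : (1 - w) * u + (1 - (1 - w)) * (v + C) = u + C by rewrite /w; field.
lra.
Qed.

End powR_lemmas.

Section borel.
Context {R : realType} {d : nat} (nm : 'rV[R]_d -> R) (nm_norm : is_norm nm).
Local Notation E := (borelRd R d).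

Lemma open_borelRd (A : set 'rV[R]_d) : open A -> measurable (A : set E).
Proof. exact: sub_sigma_algebra. Qed.

Lemma closed_borelRd (A : set 'rV[R]_d) : closed A -> measurable (A : set E).
Proof. by move=> /closed_openC/open_borelRd/measurableC; rewrite setCK. Qed.

Lemma continuous_borelRd (f : 'rV[R]_d -> R) :
  continuous f -> measurable_fun [set: E] (f : E -> R).
Proof.
move=> /continuousP cf; apply: (measurability _ (RGenOpens.measurableE R)).
move=> _ [_ [a [b ->]] <-]; rewrite setTI; apply: open_borelRd.
exact/cf/interval_open.
Qed.

Lemma lipschitz_borelRd (f : 'rV[R]_d -> R) :
  (forall x y, `|f x - f y| <= nm (x - y)) -> measurable_fun [set: E] (f : E -> R).
Proof. by move=> fl; apply: continuous_borelRd; exact: lipschitz_norm_continuous fl. Qed.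

Lemma norm_borelRd : measurable_fun [set: E] (nm : E -> R).
Proof. by apply: lipschitz_borelRd; exact: norm_dist_dist. Qed.

Lemma norm_dist_borelRd (a : 'rV[R]_d) :
  measurable_fun [set: E] (fun x : E => nm ((x : 'rV[R]_d) - a)).
Proof.
apply: lipschitz_borelRd => x y.
by rewrite (le_trans (norm_dist_dist nm_norm _ _))// opprB addrA subrK.
Qed.

Lemma rat_dense_norm (x : 'rV[R]_d) (e : R) : 0 < e ->
  exists q : 'rV[rat]_d, nm (x - map_mx ratr q) < e.
Proof.
move=> e0; have [C C0 nmC] := norm_le_mx_norm nm_norm.
pose h := e / C / 2; have h0 : 0 < h by rewrite !divr_gt0.
have rat_near i : exists q : rat, `|x 0 i - ratr q| <= h.
  have [q] : exists q : rat, ratr q \in `](x 0 i), (x 0 i + h)[.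
    by apply: rat_in_itvoo; rewrite ltrDl.
  by rewrite in_itv/= => /andP[q1 q2]; exists q; rewrite ler_norml; apply/andP; split; lra.
have [q xq] := choice rat_near; exists (\row_i q i).
rewrite (le_lt_trans (nmC _))// (@le_lt_trans _ _ (C * h))//.
  rewrite ler_pM2l//; apply: coord_ler => [|i]; first exact: ltW.
  by rewrite !mxE.
have -> : C * h = e / 2 by rewrite /h; field; rewrite gt_eqF.
by lra.
Qed.

(* The Borel sigma-algebra of a product is the product of the Borel sigma-algebras by
   separability; here the norm of the difference is enough. *)
Lemma norm_diff_measurable :
  measurable_fun [set: E * E] (fun z : E * E => nm ((z.1 : 'rV[R]_d) - (z.2 : 'rV[R]_d))).
Proof.
apply: (measurability _ (RGenInftyO.measurableE R)) => _ [_ [c ->] <-]; rewrite setTI.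
(* |x - y| < c holds if and only if |x - q| + |y - q| < c for some rational q: take q close to x,
   conversely use the triangle inequality. This is a countable union of measurable sets. *)
pose F (q : 'rV[rat]_d) (z : E * E) : R :=
  nm ((z.1 : 'rV[R]_d) - map_mx ratr q) + nm ((z.2 : 'rV[R]_d) - map_mx ratr q).
have mF q : measurable_fun [set: E * E] (F q).
  apply: measurable_funD.
    exact: (measurableT_comp (norm_dist_borelRd _) measurable_fst).
  exact: (measurableT_comp (norm_dist_borelRd _) measurable_snd).
rewrite (_ : _ @^-1` _ = \bigcup_q (F q @^-1` [set r | r < c])).
  apply: countable_bigcupT_measurable => // q.
  rewrite -[X in measurable X]setTI (_ : mkset _ = `]-oo, c[%classic); last first.
    by apply/seteqP; split => r /=; rewrite in_itv.
  exact: mF.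
apply/seteqP; split => [z /=|z [q _ /=]]; rewrite in_itv/=.
  move=> zc; have [|q zq] := rat_dense_norm (z.1 : 'rV[R]_d) (e := (c - nm (z.1 - z.2)) / 2).
    by rewrite divr_gt0// subr_gt0.
  exists q => //=; rewrite /F.
  have := norm_le_split nm_norm (z.2 : 'rV[R]_d) z.1 (map_mx ratr q).
  by rewrite (norm_sym nm_norm z.2 z.1); lra.
apply: le_lt_trans; rewrite /F (norm_sym nm_norm z.2 (map_mx _ _)).
exact: norm_le_split.
Qed.

Lemma norm_pow_borelRd (p : R) :
  measurable_fun [set: E] (fun x : E => nm x `^ p).
Proof. exact: measurableT_comp (measurable_powR p) norm_borelRd. Qed.

End borel.

(** * Couplings of two measures with partially matching parts *)

Lemma integral_prod_mul {dT : measure_display} {T : measurableType dT} {R : realType}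
    (mu nu : probability T R) (u v : T -> R) :
  measurable_fun setT u -> measurable_fun setT v ->
  (forall x, 0 <= u x) -> (forall x, 0 <= v x) ->
  (\int[mu \x nu]_z (u z.1 * v z.2)%:E =
   \int[mu]_x (u x)%:E * \int[nu]_x (v x)%:E)%E.
Proof.
move=> mu_ mv u0 v0; rewrite fubini_tonelli1 /=; last 2 first.
- by apply/measurable_EFinP/measurable_funM; exact: measurableT_comp.
- by move=> z; rewrite lee_fin mulr_ge0.
rewrite -ge0_integralZr//; last 3 first.
- exact/measurable_EFinP.
- by move=> x _; rewrite lee_fin.
- by rewrite integral_ge0// => x _; rewrite lee_fin.
apply: eq_integral => x _; rewrite /fubini_F/=.
under eq_integral do rewrite EFinM.
rewrite ge0_integralZl_EFin//; last exact/measurable_EFinP.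
by move=> y _; rewrite lee_fin.
Qed.

Section partial_parts.
Context {R : realType} {d : nat} (nm : 'rV[R]_d -> R) (nm_norm : is_norm nm).
Variables (p : R) (p1 : 1 <= p).
Local Notation E := (borelRd R d).
Variables (I : finType) (a : I -> 'rV[R]_d) (delta kap : R) (t : I -> R).
Hypothesis kap1 : kap < 1.

(** A lower bound of |x|^p on the ball of radius [delta] around [a i], where the i-th part lives. *)
Definition trimmed (i : I) : R := Num.max (nm (a i) - delta) 0 `^ p.

(** Two measures to be coupled share the masses [t]. The bound [kap] < 1 leaves a rest of positive
    mass, and [parts_eq0] makes divisions by a null mass harmless. *)
Record partial_parts (mu : probability E R) (f : I -> E -> R) : Prop := PartialParts {
  parts_measurable : forall i, measurable_fun setT (f i) ;
  parts_ge0 : forall i x, 0 <= f i x ;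
  parts_le : forall x, \sum_i f i x <= kap ;
  parts_supp : forall i x, f i x != 0 -> nm ((x : 'rV[R]_d) - a i) <= delta ;
  parts_integral : forall i, (\int[mu]_x (f i x)%:E = (t i)%:E)%E ;
  parts_eq0 : forall i, t i = 0 -> forall x, f i x = 0 }.

Lemma parts_sum_measurable mu f : partial_parts mu f ->
  measurable_fun [set: E] (fun x => \sum_i f i x).
Proof. by move=> H; apply: measurable_sum => i; exact: parts_measurable H i. Qed.

Lemma parts_rest_measurable mu f : partial_parts mu f ->
  measurable_fun [set: E] (fun x => 1 - \sum_i f i x).
Proof. by move=> /parts_sum_measurable; exact: measurable_funB. Qed.

Lemma parts_rest_ge0 mu f : partial_parts mu f -> forall x, 0 <= 1 - \sum_i f i x.
Proof. by move=> H x; rewrite subr_ge0 (le_trans (parts_le H x))// ltW. Qed.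

Lemma parts_lincomb mu f (c : I -> R) : partial_parts mu f -> (forall i, 0 <= c i) ->
  (\int[mu]_x (\sum_i c i * f i x)%:E = (\sum_i c i * t i)%:E)%E.
Proof.
move=> H c0; apply: integral_lincomb => //.
- exact: parts_measurable H.
- exact: parts_ge0 H.
- exact: parts_integral H.
Qed.

Lemma parts_sum_integral mu f : partial_parts mu f ->
  (\int[mu]_x (\sum_i f i x)%:E = (\sum_i t i)%:E)%E.
Proof.
move=> H; transitivity (\int[mu]_x (\sum_i 1 * f i x)%:E)%E.
  by apply: eq_integral => x _; congr EFin; apply: eq_bigr => i _; rewrite mul1r.
rewrite (@parts_lincomb _ _ (fun=> 1) H)//.
by congr EFin; apply: eq_bigr => i _; rewrite mul1r.
Qed.

Lemma parts_rest_integral mu f : partial_parts mu f ->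
  (\int[mu]_x (1 - \sum_i f i x)%:E = (1 - \sum_i t i)%:E)%E.
Proof.
move=> H.
have int_sum := parts_sum_integral H.
have : (\int[mu]_x ((1 - \sum_i f i x)%:E + (\sum_i f i x)%:E) = 1)%E.
  transitivity (\int[mu]_x (cst 1%E x))%E.
    by apply: eq_integral => x _; rewrite -EFinD subrK.
  by rewrite integral_cst//= mul1e probability_setT.
rewrite ge0_integralD//; last 4 first.
- by move=> x _; rewrite lee_fin; exact: parts_rest_ge0 H x.
- by apply/measurable_EFinP; exact: parts_rest_measurable H.
- by move=> x _; rewrite lee_fin sumr_ge0// => i _; exact: parts_ge0 H i x.
- by apply/measurable_EFinP; exact: parts_sum_measurable H.
rewrite int_sum EFinB => <-.
by rewrite addeK.
Qed.

(** On the support of f_i the function |x|^p is at least [trimmed i], so the parts already carry the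
    subtracted share of the moment. *)
Lemma parts_rest_moment mu f (M : R) : partial_parts mu f ->
  (\int[mu]_x (nm x `^ p)%:E = M%:E)%E ->
  (\int[mu]_x (nm x `^ p * (1 - \sum_i f i x))%:E
    <= (M - \sum_i t i * trimmed i)%:E)%E.
Proof.
move=> H intM; rewrite EFinB leeBrDr// -intM.
under [in leLHS]eq_bigr do rewrite mulrC.
rewrite -(parts_lincomb H); last by move=> i; exact: powR_ge0.
have mnp : measurable_fun [set: E] (fun x : E => nm x `^ p) by exact: norm_pow_borelRd.
have mrest : measurable_fun [set: E] (fun x : E => (nm x `^ p * (1 - \sum_i f i x))%:E).
  by apply/measurable_EFinP/measurable_funM => //; exact: parts_rest_measurable H.
have rest0 (x : E) : 0 <= nm x `^ p * (1 - \sum_i f i x).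
  by rewrite mulr_ge0 ?powR_ge0//; exact: parts_rest_ge0 H x.
have mcomb : measurable_fun [set: E] (fun x : E => (\sum_i trimmed i * f i x)%:E).
  apply/measurable_EFinP/measurable_sum => i; apply: measurable_funM => //.
  exact: parts_measurable H i.
have comb0 (x : E) : 0 <= \sum_i trimmed i * f i x.
  by rewrite sumr_ge0// => i _; rewrite mulr_ge0 ?powR_ge0//; exact: parts_ge0 H i x.
rewrite -ge0_integralD//; last 2 first.
- by move=> x _; rewrite lee_fin.
- by move=> x _; rewrite lee_fin.
apply: ge0_le_integral => //.
- by move=> x _; rewrite -EFinD lee_fin addr_ge0.
- exact: emeasurable_funD.
- exact/measurable_EFinP.
move=> x _; rewrite -EFinD lee_fin mulrBr mulr1 -addrA gerDl addrC subr_le0.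
rewrite mulr_sumr; apply: ler_sum => i _.
have [->|fx] := eqVneq (f i x) 0; first by rewrite !mulr0.
rewrite ler_wpM2r//; first exact: parts_ge0 H i x.
apply: powR_mono => //; first by rewrite le_max lexx orbT.
rewrite ge_max norm_ge0// andbT lerBlDr.
have := parts_supp H fx; have := norm_le_add nm_norm (a i) x.
by rewrite (norm_sym nm_norm); lra.
Qed.

(** Parts of equal index are coupled independently; both points are within [delta] of [a i], so the
    cost is at most (2 delta)^p. The rests have equal mass and are coupled by one more product, at a
    cost controlled by their moments. *)
Lemma coupling_of_partial_parts (mu nu : probability E R) (f g : I -> E -> R) (M M' : R) :
  0 <= delta -> partial_parts mu f -> partial_parts nu g ->
  (\int[mu]_x (nm x `^ p)%:E = M%:E)%E -> (\int[nu]_x (nm x `^ p)%:E = M'%:E)%E ->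
  exists2 pi, coupling mu nu pi &
    (\int[pi]_z (nm ((z.1 : 'rV[R]_d) - (z.2 : 'rV[R]_d)) `^ p)%:E <=
     ((2 * delta) `^ p +
      2 `^ p * (M - \sum_i t i * trimmed i + (M' - \sum_i t i * trimmed i)))%:E)%E.
Proof.
move=> delta0 Hf Hg intM intM'.
(* [None] indexes the rest, which completes the parts to a partition of unity. *)
pose ext (h : I -> E -> R) (o : option I) (x : E) : R :=
  if o is Some i then h i x else 1 - \sum_i h i x.
pose t' (o : option I) : R := if o is Some i then t i else 1 - \sum_i t i.
have big_ext (F : option I -> R) : \sum_o F o = F None + \sum_i F (Some i).
  rewrite (bigD1 None)//=; congr (_ + _).
  rewrite (reindex_omap Some id)/=; last by case.
  by apply: eq_bigl => i; rewrite eqxx.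
have ext_meas m h : partial_parts m h -> forall o, measurable_fun setT (ext h o).
  move=> H [i|]; first exact: parts_measurable H i.
  exact: parts_rest_measurable H.
have ext_ge0 m h : partial_parts m h -> forall o x, 0 <= ext h o x.
  by move=> H [i|] x; [exact: parts_ge0 H i x|exact: parts_rest_ge0 H x].
have ext1 h x : \sum_o ext h o x = 1 by rewrite big_ext /= subrK.
have ext_int m h : partial_parts m h ->
    forall o, (\int[m]_x (ext h o x)%:E = (t' o)%:E)%E.
  by move=> H [i|]; [exact: parts_integral H i|exact: parts_rest_integral H].
have theta0 : 0 < 1 - \sum_i t i.
  rewrite subr_gt0 (le_lt_trans _ kap1)// -lee_fin.
  rewrite -(parts_sum_integral Hf).
  have <- : (\int[mu]_x (cst kap%:E x) = kap%:E)%E.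
    by rewrite integral_cst//= probability_setT mule1.
  apply: ge0_le_integral => //.
  - by move=> x _; rewrite lee_fin sumr_ge0// => i _; exact: parts_ge0 Hf i x.
  - by apply/measurable_EFinP; exact: parts_sum_measurable Hf.
  - by move=> x _; rewrite lee_fin; exact: parts_le Hf x.
have t'0 o : t' o = 0 -> forall x, ext f o x = 0 /\ ext g o x = 0.
  case: o => [i|] /= ti0 x; last by move: theta0; rewrite ti0 ltxx.
  by split; [exact: parts_eq0 Hf i ti0 x|exact: parts_eq0 Hg i ti0 x].
have [pi [pi_marg pi_int]] := coupling_of_parts (ext_meas _ _ Hf) (ext_meas _ _ Hg)
  (ext_ge0 _ _ Hf) (ext_ge0 _ _ Hg) (ext1 f) (ext1 g) (ext_int _ _ Hf) (ext_int _ _ Hg) t'0.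
exists pi; first exact: pi_marg.
pose h := parts_density (ext f) (ext g) t'.
pose cost (z : E * E) : R := nm ((z.1 : 'rV[R]_d) - (z.2 : 'rV[R]_d)) `^ p.
have mcost : measurable_fun setT cost.
  exact: measurableT_comp (measurable_powR p) (norm_diff_measurable nm_norm).
have cost0 z : 0 <= cost z by exact: powR_ge0.
have t'_ge0 o : 0 <= t' o by exact: parts_mass_ge0 (ext_ge0 _ _ Hf) (ext_int _ _ Hf) o.
rewrite pi_int; last 2 first.
- by move=> z; rewrite lee_fin; exact: powR_ge0.
- by apply/measurable_EFinP; exact: mcost.
pose th := 1 - \sum_i t i.
pose restf (x : E) := nm x `^ p * (1 - \sum_i f i x).
pose restg (x : E) := nm x `^ p * (1 - \sum_i g i x).
pose rf (x : E) := 1 - \sum_i f i x.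
pose rg (x : E) := 1 - \sum_i g i x.
have rf0 x : 0 <= rf x by exact: parts_rest_ge0 Hf x.
have rg0 x : 0 <= rg x by exact: parts_rest_ge0 Hg x.
have restf0 x : 0 <= restf x by rewrite mulr_ge0 ?powR_ge0//; exact: rf0.
have restg0 x : 0 <= restg x by rewrite mulr_ge0 ?powR_ge0//; exact: rg0.
have mrf : measurable_fun setT rf by exact: parts_rest_measurable Hf.
have mrg : measurable_fun setT rg by exact: parts_rest_measurable Hg.
have mrestf : measurable_fun setT restf.
  by apply: measurable_funM => //; exact: norm_pow_borelRd.
have mrestg : measurable_fun setT restg.
  by apply: measurable_funM => //; exact: norm_pow_borelRd.
have mh : measurable_fun setT h.
  by apply: measurable_parts_density; [exact: ext_meas Hf|exact: ext_meas Hg].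
have h0 z : 0 <= h z.
  exact: (parts_density_ge0 (ext_ge0 _ _ Hf) (ext_ge0 _ _ Hg) (ext_int _ _ Hf)).
(* On the rests the cost is at most 2^p (|x|^p + |y|^p). The first term uses the whole density [h],
   of integral 1; the factor 1 matches the form of [integral_parts_fst]. *)
have bound z : cost z * h z <= (2 * delta) `^ p * (1 * h z) +
    2 `^ p / th * (restf z.1 * rg z.2 + rf z.1 * restg z.2).
  have -> : h z = th^-1 * rf z.1 * rg z.2 + \sum_i (t i)^-1 * f i z.1 * g i z.2.
    by rewrite /h /parts_density big_ext.
  set n := th^-1 * _ * _; set s := \sum_i _.
  have n0 : 0 <= n by rewrite !mulr_ge0// invr_ge0 ltW.
  have cost_s : cost z * s <= (2 * delta) `^ p * s.
    rewrite !mulr_sumr; apply: ler_sum => i _.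
    have [->|fi] := eqVneq (f i z.1) 0; first by rewrite !(mulr0, mul0r).
    have [->|gi] := eqVneq (g i z.2) 0; first by rewrite !(mulr0, mul0r).
    rewrite ler_wpM2r//.
      rewrite !mulr_ge0 ?invr_ge0 ?(parts_ge0 Hf) ?(parts_ge0 Hg)//.
      exact: t'_ge0 (Some i).
    apply: powR_mono => //; first exact: norm_ge0.
    have := norm_le_split nm_norm (z.1 : 'rV[R]_d) (a i) z.2.
    have := parts_supp Hf fi; have := parts_supp Hg gi.
    by rewrite (norm_sym nm_norm z.2); lra.
  have cost_n : cost z * n <= 2 `^ p * (nm z.1 `^ p + nm z.2 `^ p) * n.
    rewrite ler_wpM2r//; apply: le_trans (powRD_le _ _ _) => //; try exact: norm_ge0.
    apply: powR_mono => //; first exact: norm_ge0.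
    by have := is_norm_triangle nm_norm z.1 (- z.2); rewrite norm_opp.
  have d0 : 0 <= (2 * delta) `^ p * n by rewrite mulr_ge0 ?powR_ge0.
  have -> : 2 `^ p / th * (restf z.1 * rg z.2 + rf z.1 * restg z.2) =
      2 `^ p * (nm z.1 `^ p + nm z.2 `^ p) * n.
    by rewrite /n /restf /restg -/(rf _) -/(rg _); ring.
  by rewrite mul1r !mulrDr; lra.
have int_h : (\int[mu \x nu]_z (1 * h z)%:E = 1)%E.
  transitivity (\int[mu]_x (cst 1%E x))%E.
    exact: (integral_parts_fst (ext_meas _ _ Hf) (ext_meas _ _ Hg) (ext_ge0 _ _ Hf)
      (ext_ge0 _ _ Hg) (ext1 f) (ext_int _ _ Hf) (ext_int _ _ Hg) t'0 (u := cst 1)).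
  by rewrite integral_cst//= mul1e probability_setT.
have m1h : measurable_fun setT (fun z => 1 * h z) by exact: measurable_funM.
have mprod (u v : E -> R) : measurable_fun setT u -> measurable_fun setT v ->
    measurable_fun setT (fun z : E * E => u z.1 * v z.2).
  by move=> mu_ mv; apply: measurable_funM; exact: measurableT_comp.
apply: (@le_trans _ _ (\int[mu \x nu]_z (((2 * delta) `^ p)%:E * (1 * h z)%:E +
    (2 `^ p / th)%:E * ((restf z.1 * rg z.2)%:E + (rf z.1 * restg z.2)%:E))))%E.
  apply: ge0_le_integral => //.
  - by move=> z _; rewrite -EFinM lee_fin; apply: mulr_ge0; [exact: powR_ge0|exact: h0].
  - by apply: emeasurable_funM; apply/measurable_EFinP; [exact: mcost|exact: mh].
  - apply: emeasurable_funD; apply: emeasurable_funM => //.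
      exact/measurable_EFinP.
    by apply: emeasurable_funD; apply/measurable_EFinP; exact: mprod.
  - by move=> z _; have := bound z; rewrite -lee_fin.
have cth : 0 <= 2 `^ p / th by rewrite divr_ge0 ?powR_ge0// ltW.
rewrite ge0_integralD//; last 4 first.
- by move=> z _; rewrite -EFinM lee_fin !mulr_ge0 ?powR_ge0.
- by apply: emeasurable_funM => //; exact/measurable_EFinP.
- by move=> z _; rewrite -EFinD -EFinM lee_fin mulr_ge0// addr_ge0// mulr_ge0.
- by apply: emeasurable_funM => //; apply: emeasurable_funD; apply/measurable_EFinP;
    exact: mprod.
rewrite ge0_integralZl_EFin ?powR_ge0//; last 2 first.
- by move=> z _; rewrite lee_fin mul1r.
- exact/measurable_EFinP.
rewrite int_h mule1 EFinD leeD2l//.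
rewrite ge0_integralZl_EFin//; last 2 first.
- by move=> z _; rewrite -EFinD lee_fin addr_ge0// mulr_ge0.
- by apply: emeasurable_funD; apply/measurable_EFinP; exact: mprod.
rewrite ge0_integralD//; last 4 first.
- by move=> z _; rewrite lee_fin mulr_ge0.
- by apply/measurable_EFinP; exact: mprod.
- by move=> z _; rewrite lee_fin mulr_ge0.
- by apply/measurable_EFinP; exact: mprod.
rewrite !integral_prod_mul//.
rewrite (parts_rest_integral Hf) (parts_rest_integral Hg) -/th.
have leA := parts_rest_moment Hf intM; have leB := parts_rest_moment Hg intM'.
(* Each product integral contains the mass [th] of the other rest, which cancels the division by
   [th]. *)
have factor (c x y s : R) : s != 0 -> c * (x + y) = c / s * (x * s + s * y).
  by move=> s0; field.
rewrite (factor _ _ _ th) ?gt_eqF//.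
rewrite [leRHS]EFinM lee_wpmul2l ?lee_fin// [leRHS]EFinD leeD//.
- by rewrite [leRHS]EFinM lee_wpmul2r ?lee_fin// ltW.
- by rewrite [leRHS]EFinM lee_wpmul2l ?lee_fin// ltW.
Qed.

End partial_parts.

(** * Almost partitions of unity made of bumps *)

Section bumps.
Context {R : realType} {d : nat} (nm : 'rV[R]_d -> R) (nm_norm : is_norm nm).
Local Notation E := (borelRd R d).

Record bump (psi : 'rV[R]_d -> R) (rho : R) : Prop := Bump {
  bump_ge0 : forall x, 0 <= psi x ;
  bump_supp : forall x, rho <= nm x -> psi x = 0 ;
  bump_unif : forall e, 0 < e ->
    exists2 h, 0 < h & forall x y, nm (x - y) <= h -> `|psi x - psi y| <= e ;
  bump_gt0 : 0 < psi 0 }.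

Lemma bump_radius_gt0 psi rho : bump psi rho -> 0 < rho.
Proof.
move=> B; rewrite ltNge; apply/negP => rho0.
by have := bump_gt0 B; rewrite (bump_supp B) ?ltxx// norm_0.
Qed.

Definition rescale (psi : 'rV[R]_d -> R) (r : R) (a x : 'rV[R]_d) : R :=
  psi (r^-1 *: (x - a)).

(* [e] bounds the radius of the supports and the mass missed on the ball of radius M. *)
Record bump_grid psi (e M : R) n (a : 'I_n -> 'rV[R]_d)
    (r lam kap : R) : Prop := BumpGrid {
  grid_r_gt0 : 0 < r ;
  grid_lam_gt0 : 0 < lam ;
  grid_kap_lt1 : kap < 1 ;
  grid_le : forall x, \sum_i lam * rescale psi r (a i) x <= kap ;
  grid_ge : forall x, nm x <= M -> 1 - e <= \sum_i lam * rescale psi r (a i) x ;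
  grid_supp : forall i x, rescale psi r (a i) x != 0 -> nm (x - a i) <= e }.

(** The lattice sums are controlled in the sup norm, and equivalence of norms transfers this to
    [nm]. Scaling by r = e / rho shrinks the supports to radius e. *)
Lemma bump_partition psi rho (e M : R) : bump psi rho -> 0 < e ->
  exists n (a : 'I_n -> 'rV[R]_d) (r lam kap : R), bump_grid psi e M a r lam kap.
Proof.
move=> B e0; have rho0 := bump_radius_gt0 B.
have [C C0 Cnm] := mx_norm_le_norm nm_norm.
have [D D0 nmD] := norm_le_mx_norm nm_norm.
pose r := e / rho; have r0 : 0 < r by rewrite divr_gt0.
have supp x : C * rho <= `|x| -> psi x = 0.
  move=> xC; apply: (bump_supp B); rewrite -(ler_pM2l C0).
  exact: le_trans (Cnm x).
have unif e' : 0 < e' ->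
    exists2 h, 0 < h & forall x y : 'rV[R]_d, `|x - y| <= h -> `|psi x - psi y| <= e'.
  move=> /(bump_unif B)[h h0 Bh]; exists (h / D); first by rewrite divr_gt0.
  move=> x y xy; apply: Bh; rewrite (le_trans (nmD _))//.
  by rewrite mulrC -ler_pdivlMr.
have [s [lam [kap [lam0 kap1 le_kap ge_e]]]] :=
  grid_partition (bump_ge0 B) supp unif (bump_gt0 B) (C * M / r) e0.
have sumE x : \sum_(i < size s) lam * rescale psi r (r *: s`_i) x =
    lam * \sum_(a <- s) psi (r^-1 *: x - a).
  rewrite (big_nth 0) big_mkord mulr_sumr; apply: eq_bigr => i _.
  by rewrite /rescale scalerBr scalerA mulVf ?gt_eqF// scale1r.
exists (size s), (fun i => r *: s`_i), r, lam, kap; split=> //.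
- by move=> x; rewrite sumE.
- move=> x xM; rewrite sumE; apply: ge_e.
  rewrite normrZ gtr0_norm ?invr_gt0// mulrC ler_pM2r ?invr_gt0//.
  by rewrite (le_trans (Cnm x))// ler_pM2l.
- move=> i x; apply: contraNle => xe; apply/eqP/(bump_supp B).
  rewrite (is_norm_homogeneous nm_norm) gtr0_norm ?invr_gt0//.
  by rewrite ler_pdivlMl// /r divfK ?gt_eqF// ltW.
Qed.

(** A single term of an almost partition of unity is at most [kap] < 1, which bounds psi by 1 / lam.
    The family is not empty, as its sum at 0 is at least 1/2. *)
Lemma bump_bounded psi rho : bump psi rho -> exists2 K, 0 < K & forall x, psi x <= K.
Proof.
move=> B; have half0 : 0 < 2^-1 :> R by rewrite invr_gt0.
have [[|n] [a [r [lam [kap [r0 lam0 kap1 le_kap ge_half _]]]]]] :=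
  bump_partition 0 B half0.
  by have := ge_half 0; rewrite norm_0// lexx big_ord0 => /(_ isT); lra.
exists lam^-1; first by rewrite invr_gt0.
move=> y; have := le_kap (a ord0 + r *: y); rewrite big_ord_recl /rescale.
rewrite addrAC subrr add0r scalerA mulVf ?gt_eqF// scale1r => le_y.
rewrite -(ler_pM2l lam0) mulfV ?gt_eqF// (le_trans _ (ltW kap1))//.
apply: le_trans le_y; rewrite lerDl sumr_ge0// => i _.
by rewrite mulr_ge0 ?(bump_ge0 B)// ltW.
Qed.

Lemma rescale_ge0 psi rho r a x : bump psi rho -> 0 <= rescale psi r a x.
Proof. by move=> B; exact: bump_ge0 B _. Qed.

Lemma rescale_measurable psi rho r a : bump psi rho ->
  measurable_fun [set: E] (rescale psi r a : E -> R).
Proof.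
move=> B; apply: continuous_borelRd => x.
apply/(@cvgrPdist_le _ _ _ _ (nbhs_filter x)) => /= e /(bump_unif B)[h h0 Bh].
have [D D0 nmD] := norm_le_mx_norm nm_norm.
have eta0 : 0 < h / (`|r^-1| + 1) / D by rewrite !divr_gt0// ltr_wpDl.
apply/nbhs_ballP; exists (h / (`|r^-1| + 1) / D) => // y.
rewrite mx_norm_ball /ball_ /= => xy; apply: Bh.
rewrite -scalerBr (is_norm_homogeneous nm_norm) opprB addrA subrK.
have nxy : nm (x - y) <= h / (`|r^-1| + 1).
  by rewrite (le_trans (nmD _))// mulrC -ler_pdivlMr// ltW.
rewrite (@le_trans _ _ ((`|r^-1| + 1) * (h / (`|r^-1| + 1))))//.
  by rewrite ler_pM// ?norm_ge0// lerDl.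
by rewrite mulrC divfK// gt_eqF// ltr_wpDl.
Qed.

Definition rescale_integral (mu : probability E R) psi r a : R :=
  fine (\int[mu]_x (rescale psi r a x)%:E)%E.

Lemma rescale_integralE (mu : probability E R) psi rho r a : bump psi rho ->
  (\int[mu]_x (rescale psi r a x)%:E)%E = (rescale_integral mu psi r a)%:E.
Proof.
move=> B; rewrite fineK//; have [K K0 psiK] := bump_bounded B.
rewrite ge0_fin_numE; last first.
  by apply: integral_ge0 => x _; rewrite lee_fin; exact: rescale_ge0 B.
apply: (@le_lt_trans _ _ (\int[mu]_x (cst K%:E x))%E).
  apply: ge0_le_integral => //.
  - by move=> x _; rewrite lee_fin; exact: rescale_ge0 B.
  - by apply/measurable_EFinP; exact: rescale_measurable B.
  - by move=> x _; rewrite lee_fin; exact: psiK.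
by rewrite integral_cst//= probability_setT mule1 ltry.
Qed.

Variables (p : R) (p1 : 1 <= p).

Lemma wasserstein_le mu nu pi (e : R) : 0 <= e -> coupling mu nu pi ->
  (\int[pi]_z (nm ((z.1 : 'rV[R]_d) - (z.2 : 'rV[R]_d)) `^ p)%:E <= (e `^ p)%:E)%E ->
  (wasserstein nm p mu nu <= e%:E)%E.
Proof.
move=> e0 pi_coupling cost_e; rewrite -(powRK p1 e0) -poweR_EFin.
have p_ge0 : 0 <= p^-1 by rewrite invr_ge0 (le_trans ler01).
apply: gt0_ler_poweR => //.
- rewrite in_itv/= leey andbT; apply: le_ereal_inf_tmp => _ [pi' _ <-].
  by apply: integral_ge0 => z _; rewrite lee_fin powR_ge0.
- by rewrite in_itv/= leey andbT lee_fin powR_ge0.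
by apply: le_trans cost_e; apply: ereal_inf_lbound; exists pi.
Qed.

Section partitions.
Variables (psi : 'rV[R]_d -> R) (rho : R) (B : bump psi rho).

Variables (e M : R) (n : nat) (a : 'I_n -> 'rV[R]_d) (r lam kap : R).
Hypothesis G : bump_grid psi e M a r lam kap.

Let mass (mu : probability E R) i : R := lam * rescale_integral mu psi r (a i).

Lemma grid_term_ge0 i x : 0 <= lam * rescale psi r (a i) x.
Proof. by rewrite mulr_ge0 ?(rescale_ge0 _ _ _ B)// ltW// (grid_lam_gt0 G). Qed.

Lemma grid_term_measurable i :
  measurable_fun [set: E] (fun x : E => lam * rescale psi r (a i) x).
Proof. by apply: measurable_funM => //; exact: rescale_measurable B. Qed.

Lemma grid_term_integral (mu : probability E R) i :
  (\int[mu]_x (lam * rescale psi r (a i) x)%:E = (mass mu i)%:E)%E.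
Proof.
under eq_integral do rewrite EFinM.
rewrite ge0_integralZl_EFin//.
- by rewrite (rescale_integralE _ _ _ B) -EFinM.
- by move=> x _; rewrite lee_fin; exact: rescale_ge0 B.
- by apply/measurable_EFinP; exact: rescale_measurable B.
- by rewrite ltW// (grid_lam_gt0 G).
Qed.

Lemma grid_mass_ge0 mu i : 0 <= mass mu i.
Proof.
rewrite -lee_fin -grid_term_integral integral_ge0// => x _.
by rewrite lee_fin grid_term_ge0.
Qed.

(** Multiplying the i-th bump by t_i / mass_i <= 1 gives it mass t_i without enlarging its support
    or the total. If mass_i = 0, then t_i = 0 as well. *)
Lemma grid_partial_parts mu (t : 'I_n -> R) :
  (forall i, 0 <= t i) -> (forall i, t i <= mass mu i) ->
  partial_parts nm a e kap t mu
    (fun i x => t i / mass mu i * (lam * rescale psi r (a i) x)).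
Proof.
move=> t0 tm; have c0 i : 0 <= t i / mass mu i by rewrite divr_ge0// grid_mass_ge0.
have c1 i : t i / mass mu i <= 1.
  have [->|mi] := eqVneq (mass mu i) 0; first by rewrite invr0 mulr0.
  by rewrite ler_pdivrMr ?mul1r// lt_neqAle eq_sym mi grid_mass_ge0.
split.
- by move=> i; apply: measurable_funM => //; exact: grid_term_measurable.
- by move=> i x; rewrite mulr_ge0// grid_term_ge0.
- move=> x; apply: le_trans (grid_le G x); apply: ler_sum => i _.
  by rewrite ler_piMl// grid_term_ge0.
- move=> i x fx; apply: (grid_supp G); apply: contraNneq fx => ->.
  by rewrite !mulr0.
- move=> i; under eq_integral do rewrite EFinM.
  rewrite ge0_integralZl_EFin//.
  + rewrite grid_term_integral -EFinM; congr EFin.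
    have [mi|mi] := eqVneq (mass mu i) 0; last by rewrite divfK.
    by have := tm i; have := t0 i; rewrite mi mulr0; lra.
  + by move=> x _; rewrite lee_fin grid_term_ge0.
  + by apply/measurable_EFinP; exact: grid_term_measurable.
- by move=> i -> x; rewrite !mul0r.
Qed.

Lemma grid_coupling (mu nu : probability E R) (Mmu Mnu : R) : 0 <= e ->
  (\int[mu]_x (nm x `^ p)%:E = Mmu%:E)%E -> (\int[nu]_x (nm x `^ p)%:E = Mnu%:E)%E ->
  let S := \sum_i Num.min (mass mu i) (mass nu i) * trimmed nm p a e i in
  exists2 pi, coupling mu nu pi &
    (\int[pi]_z (nm ((z.1 : 'rV[R]_d) - (z.2 : 'rV[R]_d)) `^ p)%:E <=
     ((2 * e) `^ p + 2 `^ p * (Mmu - S + (Mnu - S)))%:E)%E.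
Proof.
move=> e0 intmu intnu S; pose t i := Num.min (mass mu i) (mass nu i).
have t0 i : 0 <= t i by rewrite le_min !grid_mass_ge0.
apply: (coupling_of_partial_parts nm_norm p1 (grid_kap_lt1 G) e0 _ _ intmu intnu).
- by apply: grid_partial_parts => // i; rewrite ge_min lexx.
- by apply: grid_partial_parts => // i; rewrite ge_min lexx orbT.
Qed.

(** Where the i-th bump is not 0, |a_i| - e >= |x| - 2 e, so [trimmed] loses at most 2 e (|x| +
    1)^p. The sum of the bumps misses 1 by at most e on the ball of radius M, and by at most 1
    elsewhere. *)
Lemma grid_pointwise x : 0 < e -> nm x `^ p <=
  \sum_i trimmed nm p a e i * (lam * rescale psi r (a i) x) +
  (e * nm x `^ p + nm x `^ p * \1_[set y : R | M < y] (nm x) +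
   2 * e * (nm x + 1) `^ p).
Proof.
move=> e0; pose s := \sum_i lam * rescale psi r (a i) x.
have s0 : 0 <= s by apply: sumr_ge0 => i _; exact: grid_term_ge0.
have s1 : s <= 1 by rewrite (le_trans (grid_le G x))// ltW// (grid_kap_lt1 G).
pose D := 2 * e * (nm x + 1) `^ p.
have D0 : 0 <= D by rewrite mulr_ge0 ?powR_ge0// mulr_ge0// ltW.
have nx0 := norm_ge0 nm_norm x; have np0 := powR_ge0 (nm x) p.
have step : s * (nm x `^ p - D) <= \sum_i trimmed nm p a e i * (lam * rescale psi r (a i) x).
  rewrite mulrC mulr_sumr; apply: ler_sum => i _.
  have [->|fx] := eqVneq (rescale psi r (a i) x) 0; first by rewrite !mulr0.
  rewrite ler_wpM2r ?grid_term_ge0//.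
  pose u := Num.max (nm x - 2 * e) 0.
  have u0 : 0 <= u by rewrite le_max lexx orbT.
  have ux : u <= nm x by rewrite ge_max nx0 andbT; lra.
  apply: (@le_trans _ _ (u `^ p)).
    have := powR_lipschitz p1 u0 ux (lexx _).
    have xu : nm x - u <= 2 * e.
      have : nm x - 2 * e <= u by rewrite le_max lexx.
      by lra.
    have : (nm x - u) * (nm x + 1) `^ p <= D by rewrite ler_wpM2r// powR_ge0.
    lra.
  apply: powR_mono => //; rewrite ge_max !le_max lexx !orbT andbT.
  have := grid_supp G fx; have := norm_le_add nm_norm x (a i).
  by move=> h1 h2; apply/orP; left; lra.
have : nm x `^ p * (1 - s) <= e * nm x `^ p + nm x `^ p * \1_[set y : R | M < y] (nm x).
  rewrite indicE; case: (leP (nm x) M) => xM.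
    rewrite memNset/= ?mulr0 ?addr0; last by move=> /=; rewrite ltNge xM.
    by rewrite mulrC ler_wpM2r//; have := grid_ge G xM; rewrite -/s; lra.
  rewrite mem_set//= mulr1.
  have : nm x `^ p * (1 - s) <= nm x `^ p by rewrite ler_piMr//; lra.
  have : 0 <= e * nm x `^ p by rewrite mulr_ge0// ltW.
  lra.
have : s * D <= D by rewrite ler_piMl.
by move: step; rewrite -/D mulrBr; lra.
Qed.

End partitions.

End bumps.

(** * Convergence in Wasserstein distance *)

Section convergence.
Context {R : realType} {d : nat} (nm : 'rV[R]_d -> R) (nm_norm : is_norm nm).
Variables (p : R) (p1 : 1 <= p).
Local Notation E := (borelRd R d).
Implicit Types mu nu : probability E R.

Lemma tail_measurable (k : nat) : measurable_fun [set: E]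
  (fun x : E => nm x `^ p * \1_[set y : R | k%:R < y] (nm x)).
Proof.
apply: measurable_funM; first exact: norm_pow_borelRd.
apply: measurableT_comp; last exact: norm_borelRd.
apply: measurable_indic; rewrite (_ : mkset _ = `]k%:R, +oo[%classic)//.
by apply/seteqP; split=> y /=; rewrite in_itv/= andbT.
Qed.

(** Dominated convergence: at each x the truncation is eventually 0. *)
Lemma moment_tail mu (M eta : R) : (\int[mu]_x (nm x `^ p)%:E = M%:E)%E -> 0 < eta ->
  exists k : nat,
    (\int[mu]_x (nm x `^ p * \1_[set y : R | k%:R < y] (nm x))%:E <= eta%:E)%E.
Proof.
move=> intM eta0.
have mnp : measurable_fun [set: E] (fun x : E => (nm x `^ p)%:E).
  by apply/measurable_EFinP; exact: norm_pow_borelRd.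
have cvg0 (x : E) : (nm x `^ p * \1_[set y : R | k%:R < y] (nm x))%:E @[k --> \oo] --> 0%E.
  apply: cvg_near_cst; near=> k.
  rewrite indicE memNset ?mulr0//= => kx; have : nm x <= k%:R by near: k; exact: nbhs_infty_ger.
  by rewrite leNgt kx.
have [|||||_ _] := @dominated_convergence _ E R mu setT measurableT
  (fun k x => (nm x `^ p * \1_[set y : R | k%:R < y] (nm x))%:E) (cst 0%E)
  (fun x => (nm x `^ p)%:E).
- by move=> k; apply/measurable_EFinP; exact: tail_measurable.
- exact: measurable_cst.
- by apply/aeW => x _; exact: cvg0.
- apply/integrableP; split=> //; under eq_integral do rewrite gee0_abs ?lee_fin ?powR_ge0//.
  by rewrite intM ltry.
- apply/aeW => x k _; rewrite gee0_abs ?lee_fin ?mulr_ge0 ?powR_ge0//.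
  by rewrite ler_piMr ?powR_ge0// indicE; case: (_ \in _).
rewrite integral0 => /fine_cvgP[].
move=> fin /cvgr_lt/(_ _ eta0) lt_eta; have [k [kfin keta]] := filter_ex (filterI fin lt_eta).
by exists k; move: kfin keta => /= kfin keta; rewrite -(fineK kfin) lee_fin ltW.
Unshelve. all: by end_near. Qed.

Section bump_convergence.
Variables (psi : 'rV[R]_d -> R) (rho : R) (B : bump nm psi rho).

(** The pointwise bound is integrated: the tail costs at most eta / 3 once k is large, and the other
    errors are linear in e. *)
Lemma grid_moment mu (M eta : R) : (\int[mu]_x (nm x `^ p)%:E = M%:E)%E -> 0 < eta ->
  exists e L n (a : 'I_n -> 'rV[R]_d) (r lam kap : R),
    [/\ 0 < e, e <= eta, bump_grid nm psi e L a r lam kap &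
     M - \sum_i lam * rescale_integral mu psi r (a i) * trimmed nm p a e i <= eta].
Proof.
move=> intM eta0.
have [k tail_k] := moment_tail intM (divr_gt0 eta0 (ltr0Sn R 2)).
have M0 : 0 <= M by rewrite -lee_fin -intM integral_ge0// => x _; rewrite lee_fin powR_ge0.
pose K := 2 `^ p * (M + 1).
have K0 : 0 <= K by rewrite mulr_ge0 ?powR_ge0// addr_ge0.
(* With e = eta / c, the linear errors e M + 2 e 2^p (M + 1) are at most c e / 3 = eta / 3; moreover
   c >= 1 gives e <= eta. *)
pose c := 6 * (1 + M + K); have c0 : 0 < c by rewrite /c; lra.
pose e := eta / c; have e0 : 0 < e by rewrite divr_gt0.
have [n [a [r [lam [kap G]]]]] := bump_partition nm_norm k%:R B e0.
have e_eta : e <= eta by rewrite ler_piMr ?(ltW eta0)// invf_le1// /c; lra.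
exists e, k%:R, n, a, r, lam, kap; split=> //.
have ce : c * e = eta by rewrite /e mulrC divfK ?gt_eqF.
clearbody e.
pose S (x : E) := \sum_i trimmed nm p a e i * (lam * rescale psi r (a i) x).
have S0 x : 0 <= S x.
  by apply: sumr_ge0 => i _; rewrite mulr_ge0 ?powR_ge0 ?(grid_term_ge0 B G).
have mS : measurable_fun setT S.
  apply: measurable_sum => i; apply: measurable_funM => //.
  exact: (grid_term_measurable nm_norm B).
have intS : (\int[mu]_x (S x)%:E =
    (\sum_i lam * rescale_integral mu psi r (a i) * trimmed nm p a e i)%:E)%E.
  rewrite (integral_lincomb (t := fun i => lam * rescale_integral mu psi r (a i))).
  - by congr EFin; apply: eq_bigr => i _; rewrite mulrC.
  - by move=> i; exact: (grid_term_measurable nm_norm B).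
  - by move=> i x; exact: (grid_term_ge0 B G).
  - by move=> i; exact: (grid_term_integral nm_norm B G).
  - by move=> i; exact: powR_ge0.
pose tail (x : E) := nm x `^ p * \1_[set y : R | k%:R < y] (nm x).
have tail0 x : 0 <= tail x by rewrite mulr_ge0 ?powR_ge0.
have mtail : measurable_fun setT tail by exact: tail_measurable.
pose np (x : E) := nm x `^ p.
have mnp : measurable_fun setT np by exact: norm_pow_borelRd.
have np0 x : 0 <= np x by exact: powR_ge0.
have intnp : (\int[mu]_x (np x)%:E = M%:E)%E by exact: intM.
have le_np x : np x <= S x + (tail x + (e + 2 * e * 2 `^ p) * np x + 2 * e * 2 `^ p).
  apply: le_trans (grid_pointwise nm_norm p1 B G x e0) _; rewrite lerD2l -/(tail x) -/(np x).
  have := powRD_le p1 (norm_ge0 nm_norm x) ler01; rewrite powR1 -/(np x) => h.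
  have : 2 * e * (nm x + 1) `^ p <= 2 * e * (2 `^ p * (np x + 1)).
    by rewrite ler_wpM2l// mulr_ge0// ltW.
  have -> : 2 * e * (2 `^ p * (np x + 1)) = 2 * e * 2 `^ p * np x + 2 * e * 2 `^ p by ring.
  by rewrite -/(np x) -/(tail x) !mulrDl; lra.
have b0 : 0 <= e + 2 * e * 2 `^ p.
  by rewrite addr_ge0 ?(ltW e0)// !mulr_ge0 ?powR_ge0// ltW.
have c'0 : 0 <= 2 * e * 2 `^ p by rewrite !mulr_ge0 ?powR_ge0// ltW.
have : (M%:E <= (\sum_i lam * rescale_integral mu psi r (a i) * trimmed nm p a e i)%:E
     + ((eta / 3)%:E + (e + 2 * e * 2 `^ p)%:E * M%:E + (2 * e * 2 `^ p)%:E))%E.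
  rewrite -{1}intnp -intS.
  apply: (@le_trans _ _ (\int[mu]_x ((S x)%:E + ((tail x)%:E +
      (e + 2 * e * 2 `^ p)%:E * (np x)%:E + cst (2 * e * 2 `^ p)%:E x)))%E).
    apply: ge0_le_integral => //.
    - by move=> x _; rewrite lee_fin.
    - exact/measurable_EFinP.
    - apply: emeasurable_funD; first exact/measurable_EFinP.
      apply: emeasurable_funD => //; apply: emeasurable_funD; first exact/measurable_EFinP.
      by apply: emeasurable_funM => //; exact/measurable_EFinP.
    - by move=> x _; have := le_np x; rewrite -lee_fin.
  have mtail' : measurable_fun setT (fun x => (tail x)%:E + (e + 2 * e * 2 `^ p)%:E * (np x)%:E)%E.
    apply: emeasurable_funD; first exact/measurable_EFinP.
    by apply: emeasurable_funM => //; exact/measurable_EFinP.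
  have tail'0 x : (0 <= (tail x)%:E + (e + 2 * e * 2 `^ p)%:E * (np x)%:E)%E.
    by rewrite -EFinM -EFinD lee_fin addr_ge0// mulr_ge0.
  rewrite ge0_integralD//; last 4 first.
  - by move=> x _; rewrite lee_fin.
  - exact/measurable_EFinP.
  - by move=> x _; rewrite adde_ge0//= lee_fin.
  - exact: emeasurable_funD.
  rewrite leeD2l// ge0_integralD//.
  rewrite integral_cst//= probability_setT mule1 leeD2r//.
  rewrite ge0_integralD//; last 4 first.
  - by move=> x _; rewrite lee_fin.
  - exact/measurable_EFinP.
  - by move=> x _; rewrite -EFinM lee_fin mulr_ge0.
  - by apply: emeasurable_funM => //; exact/measurable_EFinP.
  rewrite leeD// ge0_integralZl_EFin//; last exact/measurable_EFinP.
    by rewrite intnp.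
  by move=> x _; rewrite lee_fin.
rewrite -EFinM -!EFinD lee_fin.
have : c * e = 6 * e + 6 * (e * M) + 6 * (e * 2 `^ p * M) + 6 * (e * 2 `^ p).
  by rewrite /c /K; ring.
have eM0 : 0 <= e * M by rewrite mulr_ge0// ltW.
have e2 : 0 <= e * 2 `^ p by rewrite mulr_ge0 ?powR_ge0// ltW.
have e2M : 0 <= e * 2 `^ p * M by rewrite mulr_ge0.
rewrite ce mulrDl => h1 h2; nra.
Qed.

(** The grid is chosen for the limit [mu] alone. It is finite, so the common masses converge to
    those of [mu], and the cost bound of the couplings converges to a small limit. *)
Lemma wasserstein_cvg0 (mu_ : nat -> probability E R) mu (M_ : nat -> R) (M : R) :
  (forall n, (\int[mu_ n]_x (nm x `^ p)%:E = (M_ n)%:E)%E) ->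
  (\int[mu]_x (nm x `^ p)%:E = M%:E)%E -> M_ n @[n --> \oo] --> M ->
  (forall r a, 0 < r -> rescale_integral (mu_ n) psi r a @[n --> \oo]
                        --> rescale_integral mu psi r a) ->
  wasserstein nm p (mu_ n) mu @[n --> \oo] --> 0%E.
Proof.
move=> intM_ intM M_cvg psi_cvg.
suff W_small e : 0 < e -> \forall n \near \oo, (wasserstein nm p (mu_ n) mu <= e%:E)%E.
  apply/fine_cvgP; split.
    apply: filterS (W_small _ ltr01) => n W1.
    by rewrite ge0_fin_numE ?poweR_ge0// (le_lt_trans W1)// ltry.
  apply/(@cvgrPdist_le _ _ _ _ eventually_filter) => e e0.
  apply: filterS (W_small _ e0) => n We /=.
  rewrite sub0r normrN ger0_norm ?fine_ge0 ?poweR_ge0//.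
  rewrite -lee_fin fineK// ge0_fin_numE ?poweR_ge0//.
  by rewrite (le_lt_trans We)// ltry.
(* The limit cost is at most 2 eta + 2^p (eta + eta) = c eta, to be less than e^p. The bound eta <=
   1/2 ensures (2 d0)^p <= 2 d0, by convexity between 0 and 1. *)
move=> e0; pose c := 2 + 2 * 2 `^ p.
have c0 : 0 < c by rewrite ltr_pwDl// mulr_ge0// powR_ge0.
have ep0 : 0 < e `^ p by exact: powR_gt0.
pose eta := Num.min 2^-1 (e `^ p / (c + 1)).
have eta0 : 0 < eta by rewrite lt_min invr_gt0 ltr0n divr_gt0// addr_gt0.
have eta_half : eta <= 2^-1 by rewrite ge_min lexx.
have eta_e : c * eta < e `^ p.
  apply: (@lt_le_trans _ _ ((c + 1) * eta)); first by rewrite ltr_pM2r// ltrDl.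
  by rewrite mulrC -ler_pdivlMr ?addr_gt0// ge_min lexx orbT.
clearbody eta.
have [d0 [L [n [a [r [lam [kap [d00 d0eta G momS]]]]]]]] := grid_moment intM eta0.
pose T k i := Num.min (lam * rescale_integral (mu_ k) psi r (a i))
                      (lam * rescale_integral mu psi r (a i)).
pose S k := \sum_i T k i * trimmed nm p a d0 i.
pose S' := \sum_i lam * rescale_integral mu psi r (a i) * trimmed nm p a d0 i.
have r0 := grid_r_gt0 G; have lam0 := grid_lam_gt0 G.
(* The minimum of u and l is never farther from l than u is. *)
have cvgT i : T k i @[k --> \oo] --> lam * rescale_integral mu psi r (a i).
  apply/(@cvgrPdist_le _ _ _ _ eventually_filter) => e' e'0.
  have /(@cvgrPdist_le _ _ _ _ eventually_filter)/(_ _ e'0) :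
      lam * rescale_integral (mu_ k) psi r (a i) @[k --> \oo] -->
      lam * rescale_integral mu psi r (a i) by apply: cvgMl_tmp; exact: psi_cvg.
  apply: filterS => k /=; rewrite /T; set u := lam * _; set l := lam * _.
  by case: (leP u l) => // _ _; rewrite subrr normr0 ltW.
have cvgS : S k @[k --> \oo] --> S'.
  apply: cvg_big => [|i _]; first exact: add_continuous.
  exact: cvgMr_tmp.
have pow_d0 : (2 * d0) `^ p <= 2 * eta.
  have w0 : 0 <= 2 * d0 by rewrite mulr_ge0// ltW.
  have w1 : 2 * d0 <= 1 by lra.
  have := powR_convex p1 w0 w1 ler01 (lexx 0).
  rewrite mulr1 mulr0 addr0 powR1 powR0 ?gt_eqF ?(lt_le_trans ltr01)//.
  by rewrite mulr1 mulr0 addr0; lra.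
pose X k := (2 * d0) `^ p + 2 `^ p * (M_ k - S k + (M - S k)).
have cvgX : X k @[k --> \oo] --> (2 * d0) `^ p + 2 `^ p * (M - S' + (M - S')).
  apply: cvgD; first exact: cvg_cst.
  apply: cvgMl_tmp; apply: cvgD; first exact: cvgB.
  by apply: cvgB => //; exact: cvg_cst.
have limX : (2 * d0) `^ p + 2 `^ p * (M - S' + (M - S')) < e `^ p.
  apply: le_lt_trans eta_e; rewrite /c.
  have := ler_wpM2l (powR_ge0 2 p) momS; rewrite -/S'; lra.
apply: filterS (cvgr_le _ cvgX _ limX) => k Xk.
have [pi pi_coupling pi_cost] := grid_coupling nm_norm p1 B G (ltW d00) (intM_ k) intM.
apply: (wasserstein_le p1 (ltW e0) pi_coupling).
by rewrite (le_trans pi_cost)// lee_fin.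
Qed.
End bump_convergence.
End convergence.

(** * Equality of measures *)

Section equality_of_measures.
Context {R : realType} {d : nat} (nm : 'rV[R]_d -> R) (nm_norm : is_norm nm).
Local Notation E := (borelRd R d).
Implicit Types mu nu : probability E R.

Definition thicken (A : set 'rV[R]_d) (c : R) : set 'rV[R]_d :=
  [set x | exists2 z, A z & nm (x - z) < c].

Lemma thicken_open A c : open (thicken A c).
Proof.
rewrite (_ : thicken A c = \bigcup_(z in A) [set x | nm (x - z) < c]).
  apply: bigcup_open => z _.
  rewrite (_ : mkset _ = (fun x => nm (x - z)) @^-1` [set y : R | y < c])//.
  apply: open_comp; last exact: open_lt.
  move=> x _; apply: (lipschitz_norm_continuous nm_norm) => {}x y.
  by rewrite (le_trans (norm_dist_dist nm_norm _ _))// opprB addrA subrK.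
by apply/seteqP; split=> x [z Az xz]; exists z.
Qed.

Lemma thicken_measurable A c : measurable (thicken A c : set E).
Proof. by apply: open_borelRd; exact: thicken_open. Qed.

Lemma bigcap_thicken (A : set 'rV[R]_d) : closed A ->
  \bigcap_k thicken A (3 * k.+1%:R^-1) = A.
Proof.
move=> cA; apply/seteqP; split=> [x xA|x Ax k _]; last first.
  by exists x => //; rewrite subrr norm_0// mulr_gt0 ?invr_gt0.
apply: cA => U /nbhs_ballP[e /= e0 eU].
have [C C0 Cnm] := mx_norm_le_norm nm_norm.
have eC : 0 < e / C / 3 by rewrite !divr_gt0.
pose k := Num.truncn (e / C / 3)^-1.
have [z Az xz] := xA k I; exists z; split=> //; apply: eU.
rewrite mx_norm_ball /ball_ /= (le_lt_trans (Cnm _))// mulrC -ltr_pdivlMr//.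
rewrite (lt_trans xz)// mulrC -ltr_pdivlMr// -[ltRHS]invrK ltf_pV2 ?posrE ?invr_gt0//.
exact: truncnS_gt.
Qed.

Lemma thicken_cvg mu A : closed A ->
  mu (thicken A (3 * k.+1%:R^-1)) @[k --> \oo] --> mu (A : set E).
Proof.
move=> cA; rewrite -[in X in _ --> X](bigcap_thicken cA).
apply: nonincreasing_cvg_mu.
- by rewrite (le_lt_trans (probability_le1 _ _)) ?ltry//; exact: thicken_measurable.
- by move=> k; exact: thicken_measurable.
- by rewrite bigcap_thicken//; exact: closed_borelRd.
move=> m n mn; apply/subsetPset => x [z Az xz]; exists z => //.
rewrite (lt_le_trans xz)// ler_pM2l// lef_pV2 ?posrE// ler_nat.
exact: mn.
Qed.

Definition far (k : nat) : set E := [set x : E | k%:R < nm x].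

Lemma far_measurable k : measurable (far k).
Proof.
rewrite -[far k]setTI (_ : far k = (nm : E -> R) @^-1` `]k%:R, +oo[).
  by apply: (norm_borelRd nm_norm) => //.
by apply/seteqP; split=> x; rewrite /far/= in_itv/= andbT.
Qed.

Lemma far_cvg mu : mu (far k) @[k --> \oo] --> 0%E.
Proof.
have cap0 : \bigcap_k far k = set0.
  apply/seteqP; split=> // x /(_ (Num.truncn (nm x)).+1 I); rewrite /far/=.
  by rewrite ltNge ltW// truncnS_gt.
rewrite -(measure0 mu) -cap0; apply: nonincreasing_cvg_mu.
- by rewrite (le_lt_trans (probability_le1 _ _)) ?ltry//; exact: far_measurable.
- by move=> k; exact: far_measurable.
- by rewrite cap0.
move=> m n mn; apply/subsetPset => x; rewrite /far/=; apply: le_lt_trans.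
by rewrite ler_nat.
Qed.

Section bump_domination.
Variables (psi : 'rV[R]_d -> R) (rho : R) (B : bump nm psi rho) (mu nu : probability E R).
Hypothesis dom : forall r a, 0 < r ->
  rescale_integral nu psi r a <= rescale_integral mu psi r a.

(** Only the bumps whose centre is within e = 1 / (k + 1) of A are summed. On A, inside the ball of
    radius k, no other bump counts and the sum is at least 1 - e. Where it is not 0, the distance to
    A is at most 2 e < 3 e. *)
Lemma bump_thicken_le (A : set 'rV[R]_d) k : measurable (A : set E) ->
  (nu A <= mu (thicken A (3 * k.+1%:R^-1)) + k.+1%:R^-1%:E + nu (far k))%E.
Proof.
move=> mA; have e0 : 0 < k.+1%:R^-1 :> R by rewrite invr_gt0.
set e := k.+1%:R^-1 in e0 *.
have [n [a [r [lam [kap G]]]]] := bump_partition nm_norm k%:R B e0.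
pose J i := `[< exists2 z, A z & nm (z - a i) <= e >].
pose chi i x := lam * rescale psi r (a i) x.
pose s (x : E) := \sum_i (J i)%:R * chi i x.
have chi0 i x : 0 <= chi i x by exact: (grid_term_ge0 B G).
have s0 x : 0 <= s x by apply: sumr_ge0 => i _; rewrite mulr_ge0.
have ms : measurable_fun setT s.
  apply: measurable_sum => i; apply: measurable_funM => //.
  exact: (grid_term_measurable nm_norm B).
have int_s (m : probability E R) : (\int[m]_x (s x)%:E =
    (\sum_i (J i)%:R * (lam * rescale_integral m psi r (a i)))%:E)%E.
  apply: integral_lincomb => // i; first exact: (grid_term_measurable nm_norm B).
  exact: (grid_term_integral nm_norm B G).
have int_indic (m : probability E R) (D : set E) : measurable D -> (\int[m]_x (\1_D x)%:E = m D)%E.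
  by move=> mD; rewrite integral_indic// setIT.
have mT := thicken_measurable A (3 * e).
have mF := far_measurable k.
have supp i x : chi i x != 0 -> nm (x - a i) <= e.
  by move=> chix; apply: (grid_supp G); apply: contraNneq chix; rewrite /chi => ->; rewrite mulr0.
have le1 x : \1_A x <= s x + e + \1_(far k) x.
  rewrite indicE; case: (boolP (x \in A)) => [|_]; last first.
    by rewrite !addr_ge0// ltW.
  rewrite inE => Ax.
  have sE : s x = \sum_i chi i x.
    apply: eq_bigr => i _; case: (boolP (J i)) => [_|/asboolPn nJ]; first by rewrite mul1r.
    rewrite mul0r; have [->//|/supp xi] := eqVneq (chi i x) 0.
    by exfalso; apply: nJ; exists x.
  rewrite indicE; case: (boolP (x \in far k)) => [_|].
    by rewrite /= lerDr addr_ge0// ltW.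
  rewrite notin_setE /far/= => /negP; rewrite -leNgt => /(grid_ge G).
  by rewrite sE addr0 -/chi; rewrite lerBlDr.
have le2 x : s x <= \1_(thicken A (3 * e)) x.
  rewrite indicE; case: (boolP (x \in _)) => [_|].
    apply: (@le_trans _ _ (\sum_i chi i x)).
      by apply: ler_sum => i _; rewrite ler_piMl// lern1 leq_b1.
    by rewrite (le_trans (grid_le G x))// ltW// (grid_kap_lt1 G).
  rewrite notin_setE => nT; rewrite /s big1// => i _.
  case: (boolP (J i)) => [/asboolP[z Az zi]|_]; last by rewrite mul0r.
  rewrite mul1r.
  have [//|/supp xi] := eqVneq (chi i x) 0.
  exfalso; apply: nT; exists z => //.
  have := norm_le_split nm_norm x (a i) z; rewrite (norm_sym nm_norm (a i) z); lra.
rewrite -int_indic//.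
apply: (@le_trans _ _ (\int[nu]_x ((s x)%:E + cst e%:E x + (\1_(far k) x)%:E)))%E.
  apply: ge0_le_integral => //.
  - exact/measurable_EFinP.
  - apply: emeasurable_funD; last exact/measurable_EFinP.
    by apply: emeasurable_funD => //; exact/measurable_EFinP.
  - by move=> x _; have := le1 x; rewrite -lee_fin.
rewrite ge0_integralD//; last 3 first.
- by move=> x _; rewrite adde_ge0//= lee_fin// ltW.
- by apply: emeasurable_funD => //; exact/measurable_EFinP.
- exact/measurable_EFinP.
rewrite ge0_integralD//; last 3 first.
- by move=> x _; rewrite lee_fin.
- exact/measurable_EFinP.
- by move=> x _; rewrite /= lee_fin ltW.
rewrite int_indic// leeD2r// integral_cst//= probability_setT mule1 leeD2r//.
apply: (@le_trans _ _ (\int[mu]_x (s x)%:E))%E.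
  rewrite !int_s lee_fin; apply: ler_sum => i _.
  by rewrite ler_wpM2l// ler_pM2l ?(grid_lam_gt0 G)// dom// (grid_r_gt0 G).
rewrite -int_indic//; apply: ge0_le_integral => //.
- by move=> x _; rewrite lee_fin.
- exact/measurable_EFinP.
- exact/measurable_EFinP.
- by move=> x _; rewrite lee_fin.
Qed.

Lemma cvg_thicken_bound (A : set 'rV[R]_d) : closed A ->
  (mu (thicken A (3 * k.+1%:R^-1)) + k.+1%:R^-1%:E + nu (far k))%E @[k --> \oo]
  --> mu (A : set E).
Proof.
move=> cA; rewrite -[X in _ --> X]adde0 -[X in _ --> (X + _)%E]adde0.
apply: cvgeD; last exact: far_cvg.
  by rewrite adde0 fin_num_adde_defl.
apply: cvgeD; [by rewrite fin_num_adde_defl|exact: thicken_cvg|exact: cvge_harmonic].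
Qed.

End bump_domination.

(** Complements pass to open sets, which are stable under intersection and generate the Borel
    sets. *)
Lemma same_measure_of_closed mu nu :
  (forall A : set 'rV[R]_d, closed A -> nu (A : set E) = mu (A : set E)) ->
  same_measure mu nu.
Proof.
move=> closedE A mA.
apply: (@g_sigma_algebra_measure_unique _ R E (@open 'rV[R]_d) _ (fun=> setT) _ _
  mu nu _ _ _ A mA) => //.
- by move=> U oU; exact: open_borelRd.
- by move=> _; exact: openT.
- by apply/seteqP; split=> // x _; exists 0%N.
- by move=> U V; exact: openI.
- move=> U oU; rewrite -[U]setCK.
  have mU : measurable (~` U : set E) by apply: closed_borelRd; exact: open_closedC.
  rewrite [LHS](probability_setC mu mU) [RHS](probability_setC nu mU) closedE//.
  exact: open_closedC.
- by move=> _; rewrite (le_lt_trans (probability_le1 mu measurableT)) ?ltry.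
Qed.

(** Letting k tend to infinity gives nu <= mu on closed sets, hence mu <= nu on open sets as both
    masses are 1. The thickenings of a closed set are open and decrease to it, which gives mu <= nu
    on closed sets too. *)
Theorem same_measure_of_bumps psi rho (B : bump nm psi rho) mu nu :
  (forall r a, 0 < r -> rescale_integral nu psi r a <= rescale_integral mu psi r a) ->
  same_measure mu nu.
Proof.
move=> dom.
have le_closed A : closed A -> (nu (A : set E) <= mu (A : set E))%E.
  move=> cA; apply: cvge_ge (cvg_thicken_bound nu cA).
  by apply: nearW => k; apply: (bump_thicken_le B dom); exact: closed_borelRd.
apply: same_measure_of_closed => A cA; apply/eqP; rewrite eq_le le_closed//=.
have le_thicken k : (mu (thicken A (3 * k.+1%:R^-1)) <= nu (thicken A (3 * k.+1%:R^-1)))%E.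
  set T := thicken _ _; have oT : open T by exact: thicken_open.
  have mT : measurable (~` T : set E) by apply: closed_borelRd; exact: open_closedC.
  rewrite -[T]setCK (probability_setC mu mT) (probability_setC nu mT) leeB//.
  by apply: le_closed; exact: open_closedC.
have mu_cvg := thicken_cvg (mu := mu) cA; have nu_cvg := thicken_cvg (mu := nu) cA.
rewrite -(cvg_lim _ mu_cvg)// -(cvg_lim _ nu_cvg)//.
apply: lee_lim; last exact: nearW.
- by apply/cvg_ex; eexists; exact: mu_cvg.
- by apply/cvg_ex; eexists; exact: nu_cvg.
Qed.

End equality_of_measures.

(** * The bump of a bounded cell *)

Lemma bigmin_EFin_ex {R : realType} N (i0 : 'I_N) (F : 'I_N -> R) :
  exists2 i, \big[Order.min/+oo%E]_(i < N) (F i)%:E = (F i)%:E & forall j, F i <= F j.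
Proof.
have [i _ Fi] := @Order.TotalTheory.arg_minP _ R _ i0 xpredT F isT.
exists i => [|j]; last exact: Fi.
apply/le_anti/andP; split; first exact: bigmin_le.
by apply/bigmin_geP; split=> [|j _]; rewrite ?leey// lee_fin Fi.
Qed.

Section nearest.
Context {R : realType} {d : nat} (nm : 'rV[R]_d -> R) (nm_norm : is_norm nm).
Variables (p : R) (p1 : 1 <= p).
Variables (N : nat).
Local Notation E := (borelRd R d).
Implicit Types (x : 'I_N -> 'rV[R]_d).

(** The minimum starts from [+oo], as in the quantization error; an index, such as [i0] below, makes
    it finite and attained. *)
Definition nearest x (z : 'rV[R]_d) : R :=
  fine (\big[Order.min/+oo]_(i < N) (nm (z - x i))%:E)%E.

Variable (i0 : 'I_N).

Lemma nearest_ex x z :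
  exists2 i, nearest x z = nm (z - x i) & forall j, nearest x z <= nm (z - x j).
Proof.
have [i Fi Fmin] := bigmin_EFin_ex i0 (fun i => nm (z - x i)).
by exists i; rewrite /nearest Fi.
Qed.

Lemma nearest_le x z j : nearest x z <= nm (z - x j).
Proof. by have [i _] := nearest_ex x z. Qed.

Lemma nearest_ge0 x z : 0 <= nearest x z.
Proof. by have [i -> _] := nearest_ex x z; exact: norm_ge0. Qed.

Lemma le_nearest x z (c : R) : (forall i, c <= nm (z - x i)) -> c <= nearest x z.
Proof. by have [i -> _] := nearest_ex x z. Qed.

Lemma nearest_pow x z :
  (\big[Order.min/+oo]_(i < N) (nm (z - x i) `^ p)%:E = (nearest x z `^ p)%:E)%E.
Proof.
have [i -> Fmin] := bigmin_EFin_ex i0 (fun i => nm (z - x i) `^ p); congr EFin.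
apply/le_anti/andP; split.
  by have [j -> _] := nearest_ex x z; exact: Fmin.
by apply: powR_mono; [exact: p1|exact: nearest_ge0|exact: nearest_le].
Qed.

Lemma nearest_lipschitz x y z : `|nearest x y - nearest x z| <= nm (y - z).
Proof.
have le_near u v : nearest x u <= nearest x v + nm (u - v).
  rewrite -lerBlDr; apply: le_nearest => i; rewrite lerBlDr addrC.
  exact: le_trans (nearest_le _ _ i) (norm_le_split nm_norm _ _ _).
rewrite ler_norml; have := le_near y z; have := le_near z y.
by rewrite (norm_sym nm_norm z) => ? ?; apply/andP; split; lra.
Qed.

Lemma nearest_scale x r a z : 0 < r ->
  nearest (fun i => a + r *: x i) z = r * nearest x (r^-1 *: (z - a)).
Proof.
move=> r0; have termE i : nm (z - (a + r *: x i)) = r * nm (r^-1 *: (z - a) - x i).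
  rewrite (_ : z - _ = r *: (r^-1 *: (z - a) - x i)).
    by rewrite (is_norm_homogeneous nm_norm) gtr0_norm.
  by rewrite scalerBr scalerA mulfV ?gt_eqF// scale1r opprD addrA.
apply/le_anti/andP; split.
  by have [i -> _] := nearest_ex x (r^-1 *: (z - a)); rewrite -termE; exact: nearest_le.
by apply: le_nearest => i; rewrite termE ler_pM2l//; exact: nearest_le.
Qed.

Lemma nearest_measurable x : measurable_fun [set: E] (nearest x : E -> R).
Proof. by apply: (lipschitz_borelRd nm_norm); exact: nearest_lipschitz. Qed.

Lemma nearest_pow_measurable x :
  measurable_fun [set: E] (fun z : E => nearest x z `^ p).
Proof. exact: measurableT_comp (measurable_powR p) (nearest_measurable x). Qed.

Lemma moment_fin (mu : probability E R) : finite_moment nm p mu ->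
  exists2 M, (\int[mu]_z (nm z `^ p)%:E = M%:E)%E & 0 <= M.
Proof.
move=> fin; have m0 : (0 <= \int[mu]_z (nm z `^ p)%:E)%E.
  by apply: integral_ge0 => z _; rewrite lee_fin powR_ge0.
exists (fine (\int[mu]_z (nm z `^ p)%:E)%E); last exact: fine_ge0.
by rewrite fineK// ge0_fin_numE.
Qed.

(** The p-th power of the quantization error, which unlike the error itself is linear in [mu]. *)
Definition qpow (mu : probability E R) x : R :=
  fine (\int[mu]_z (nearest x z `^ p)%:E)%E.

Lemma qpow_ge0 mu x : 0 <= qpow mu x.
Proof. by apply/fine_ge0/integral_ge0 => z _; rewrite lee_fin powR_ge0. Qed.

Lemma qpowE (mu : probability E R) x : finite_moment nm p mu ->
  (\int[mu]_z (nearest x z `^ p)%:E = (qpow mu x)%:E)%E.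
Proof.
move=> /moment_fin[M intM M0]; rewrite fineK// ge0_fin_numE; last first.
  by apply: integral_ge0 => z _; rewrite lee_fin powR_ge0.
pose c := 2 `^ p * nm (x i0) `^ p.
have c0 : 0 <= c by rewrite mulr_ge0 ?powR_ge0.
have mnp : measurable_fun [set: E] (fun z : E => (nm z `^ p)%:E).
  by apply/measurable_EFinP; exact: norm_pow_borelRd.
apply: (@le_lt_trans _ _ (\int[mu]_z ((2 `^ p)%:E * (nm z `^ p)%:E + cst c%:E z)))%E.
  apply: ge0_le_integral => //.
  - by move=> z _; rewrite lee_fin powR_ge0.
  - by apply/measurable_EFinP; exact: nearest_pow_measurable.
  - by apply: emeasurable_funD => //; apply: emeasurable_funM.
  move=> z _; rewrite -EFinM -EFinD lee_fin /c -mulrDr.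
  apply: le_trans (powRD_le p1 (norm_ge0 nm_norm z) (norm_ge0 nm_norm (x i0))).
  apply: powR_mono => //; first exact: nearest_ge0.
  apply: le_trans (nearest_le _ _ i0) _.
  by have := is_norm_triangle nm_norm z (- x i0); rewrite norm_opp.
rewrite ge0_integralD//; last 2 first.
- by move=> z _; rewrite -EFinM lee_fin mulr_ge0 ?powR_ge0.
- by apply: emeasurable_funM.
rewrite ge0_integralZl_EFin ?powR_ge0//; last by move=> z _; rewrite lee_fin powR_ge0.
by rewrite intM integral_cst//= probability_setT mule1 -EFinM -EFinD ltry.
Qed.

Lemma quantization_errorE mu x : quantization_error nm p mu x = qpow mu x `^ p^-1.
Proof.
rewrite /quantization_error /qpow; congr (fine _ `^ _).
by apply: eq_integral => z _; rewrite nearest_pow.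
Qed.

Lemma quantization_error_ge0 (mu : probability E R) x : 0 <= quantization_error nm p mu x.
Proof. exact: powR_ge0. Qed.

Lemma quantization_error_pow mu x : quantization_error nm p mu x `^ p = qpow mu x.
Proof. by rewrite quantization_errorE powRVK// qpow_ge0. Qed.

(** The grid with all points at 0 makes the moments readable from the errors. *)
Lemma qpow_const (mu : probability E R) (M : R) :
  (\int[mu]_z (nm z `^ p)%:E = M%:E)%E -> qpow mu (fun=> 0) = M.
Proof.
move=> intM; rewrite /qpow (eq_integral (fun z : E => (nm z `^ p)%:E)) ?intM// => z _.
have near0 : nearest (fun=> 0) z = nm z by have [i -> _] := nearest_ex (fun=> 0) z; rewrite subr0.
by rewrite near0.
Qed.

End nearest.

Section cell_bump.
Context {R : realType} {d : nat} (nm : 'rV[R]_d -> R) (nm_norm : is_norm nm).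
Variables (p : R) (p1 : 1 <= p) (N : nat) (b : 'I_N -> 'rV[R]_d) (i0 : 'I_N) (rho : R).
Hypothesis cell : bounded_cell nm b i0 rho.
Local Notation E := (borelRd R d).

Definition recentred (i : 'I_N) : 'rV[R]_d := if i == i0 then 0 else b i.

Definition cell_bump (z : 'rV[R]_d) : R :=
  nearest nm b z `^ p - nearest nm recentred z `^ p.

(** The duplicate of [b i0] survives, so [recentred] still contains every point of [b]. *)
Lemma nearest_recentred_le z : nearest nm recentred z <= nearest nm b z.
Proof.
have [_ [j ji bj] _] := cell; apply: (le_nearest i0) => i.
have [->|ii0] := eqVneq i i0.
  by have := nearest_le nm i0 recentred z j; rewrite /recentred (negbTE ji) bj.
by have := nearest_le nm i0 recentred z i; rewrite /recentred (negbTE ii0).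
Qed.

(** Beyond radius rho some surviving b_j is as close as 0, so the two minima agree; at 0 only one of
    them vanishes, as no b_i is 0. Uniform continuity holds because both minima are 1-Lipschitz and
    t^p is Lipschitz on bounded intervals. *)
Lemma bump_cell_bump : bump nm cell_bump rho.
Proof.
have [bn0 [j0 j0i bj0] far] := cell.
have p0 : 0 < p by exact: lt_le_trans p1.
have supp z : rho <= nm z -> cell_bump z = 0.
  move=> /far[j ji zj]; apply/eqP; rewrite subr_eq0; apply/eqP; congr (_ `^ p).
  apply/le_anti; rewrite nearest_recentred_le andbT.
  apply: (le_nearest i0) => i; rewrite /recentred; case: ifP => _.
    by rewrite subr0 (le_trans _ zj)//; exact: nearest_le.
  exact: nearest_le.
split=> //.
- move=> z; rewrite subr_ge0; apply: powR_mono => //; first exact: (nearest_ge0 nm_norm i0).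
  exact: nearest_recentred_le.
(* [Q] bounds both minima on the ball of radius rho + 1; [K] below adds up their two Lipschitz
   constants. *)
- move=> e e0; pose Q := rho + 1 + nm (b i0).
  have [rho0|rho0] := leP (rho + 1) 0.
    exists 1 => // x y _; rewrite !supp ?subrr ?normr0 ?(ltW e0)//.
      by rewrite (le_trans _ (norm_ge0 nm_norm _))//; lra.
    by rewrite (le_trans _ (norm_ge0 nm_norm _))//; lra.
  have Q0 : 0 < Q by rewrite ltr_wpDr// norm_ge0.
  pose K := 2 * (Q + 1) `^ p + 1.
  have K0 : 0 < K by rewrite ltr_wpDl// mulr_ge0 ?powR_ge0.
  (* If one of two points at distance at most 1 lies beyond rho + 1, both lie beyond rho, where the
     bump vanishes. *)
  exists (Num.min 1 (e / K)); first by rewrite lt_min ltr01 divr_gt0.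
  have pow_close (x : 'I_N -> 'rV[R]_d) (y z : 'rV[R]_d) :
      nearest nm x y <= Q -> nearest nm x z <= Q ->
      `|nearest nm x y `^ p - nearest nm x z `^ p| <= nm (y - z) * (Q + 1) `^ p.
    wlog yz : y z / nearest nm x z <= nearest nm x y.
      move=> H; have [zy|/ltW yz] := leP (nearest nm x z) (nearest nm x y); first exact: H.
      by move=> ? ?; rewrite distrC (norm_sym nm_norm); exact: H.
    move=> yQ zQ; rewrite ger0_norm ?subr_ge0; last first.
      by apply: powR_mono => //; exact: (nearest_ge0 nm_norm i0).
    apply: le_trans (powR_lipschitz p1 (nearest_ge0 nm_norm i0 _ _) yz yQ) _.
    rewrite ler_wpM2r ?powR_ge0//.
    exact: le_trans (ler_norm _) (nearest_lipschitz nm_norm i0 x y z).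
  move=> y z; rewrite le_min => /andP[yz1 yzK].
  have [rx|rx] := leP (rho + 1) (nm y).
    rewrite !supp ?subrr ?normr0 ?(ltW e0)//; last by lra.
    by have := norm_le_add nm_norm y z; lra.
  have [ry|ry] := leP (rho + 1) (nm z).
    rewrite !supp ?subrr ?normr0 ?(ltW e0)//; first by lra.
    by have := norm_le_add nm_norm z y; rewrite (norm_sym nm_norm); lra.
  have bQ u : nm u <= rho + 1 -> nearest nm b u <= Q.
    move=> u1; apply: le_trans (nearest_le nm i0 _ _ i0) _; rewrite /Q.
    by have := is_norm_triangle nm_norm u (- b i0); rewrite norm_opp//; lra.
  have cQ u : nm u <= rho + 1 -> nearest nm recentred u <= Q.
    by move=> u1; rewrite (le_trans (nearest_recentred_le u))// bQ.
  have h1 := pow_close b y z (bQ _ (ltW rx)) (bQ _ (ltW ry)).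
  have h2 := pow_close recentred y z (cQ _ (ltW rx)) (cQ _ (ltW ry)).
  have -> : cell_bump y - cell_bump z = (nearest nm b y `^ p - nearest nm b z `^ p) -
      (nearest nm recentred y `^ p - nearest nm recentred z `^ p).
    have regroup (s t u v : R) : s - t - (u - v) = s - u - (t - v) by ring.
    exact: regroup.
  apply: le_trans (ler_normB _ _) _.
  apply: (@le_trans _ _ (nm (y - z) * K)); last by rewrite -ler_pdivlMr.
  move: h1 h2 (norm_ge0 nm_norm (y - z)); rewrite /K; move: (nm (y - z)) => h.
  move: (`|_ - _|) (`|_ - _|) => u v h1 h2 h0; lra.
- rewrite /cell_bump.
  have -> : nearest nm recentred 0 = 0.
    apply/le_anti; rewrite (nearest_ge0 nm_norm i0)// andbT.
    by have := nearest_le nm i0 recentred 0 i0; rewrite /recentred eqxx subrr (norm_0 nm_norm).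
  have [i -> _] := nearest_ex nm i0 b 0; rewrite powR0 ?gt_eqF// subr0 powR_gt0//.
  rewrite sub0r norm_opp// lt_neqAle norm_ge0// andbT eq_sym.
  by apply/eqP => /(is_norm_definite nm_norm) bi0; have := bn0 i; rewrite bi0 eqxx.
Qed.

Definition shifted (r : R) (a : 'rV[R]_d) (x : 'I_N -> 'rV[R]_d) (i : 'I_N) : 'rV[R]_d :=
  a + r *: x i.

(** By homogeneity, scaling a grid by r multiplies the minima by r, so the two integrands differ by
    r^p times the rescaled bump. *)
Lemma rescale_integral_cell_bump (mu : probability E R) r a :
  finite_moment nm p mu -> 0 < r ->
  rescale_integral mu cell_bump r a = (r `^ p)^-1 *
   (qpow nm p mu (shifted r a b) - qpow nm p mu (shifted r a recentred)).
Proof.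
move=> fin r0; have B := bump_cell_bump.
have rp0 : 0 < r `^ p by exact: powR_gt0.
have intb := qpowE nm_norm p1 i0 (shifted r a b) fin.
have intc := qpowE nm_norm p1 i0 (shifted r a recentred) fin.
have intr := rescale_integralE nm_norm mu r a B.
(* Written as a sum of nonnegative integrals, to avoid subtraction in the extended reals. *)
have key : (\int[mu]_z (nearest nm (shifted r a b) z `^ p)%:E =
    (r `^ p)%:E * (\int[mu]_z (rescale cell_bump r a z)%:E) +
    \int[mu]_z (nearest nm (shifted r a recentred) z `^ p)%:E)%E.
  rewrite -ge0_integralZl_EFin ?(ltW rp0)//; last 2 first.
  - by move=> z _; rewrite lee_fin; exact: rescale_ge0 B.
  - by apply/measurable_EFinP; exact: (rescale_measurable nm_norm _ _ B).
  rewrite -ge0_integralD//; last 4 first.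
  - by move=> z _; rewrite -EFinM lee_fin mulr_ge0 ?powR_ge0//; exact: rescale_ge0 B.
  - apply: emeasurable_funM => //; apply/measurable_EFinP.
    exact: (rescale_measurable nm_norm _ _ B).
  - by move=> z _; rewrite lee_fin powR_ge0.
  - by apply/measurable_EFinP; exact: (nearest_pow_measurable nm_norm p i0).
  apply: eq_integral => z _; rewrite -EFinM -EFinD; congr EFin.
  rewrite /shifted !(nearest_scale nm_norm i0)// !powRM ?(ltW r0) ?(nearest_ge0 nm_norm i0)//.
  by rewrite /rescale /cell_bump -mulrDr subrK.
move: key; rewrite [X in X = _]intb [X in _ = (_ + X)%E]intc [X in _ = (_ * X + _)%E]intr.
rewrite -EFinM -EFinD => -[->].
by rewrite addrK mulKf// gt_eqF.
Qed.

End cell_bump.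

(** * The quantization distance *)

Lemma powR_cvg {R : realType} (p : R) (u : nat -> R) (l : R) : 1 <= p ->
  (forall n, 0 <= u n) -> 0 <= l -> u n @[n --> \oo] --> l ->
  u n `^ p @[n --> \oo] --> l `^ p.
Proof.
move=> p1 u0 l0 ul; apply/(@cvgrPdist_le _ _ _ _ eventually_filter) => e e0.
(* The Lipschitz constant of t^p on [0, l + 1] given by [powR_lipschitz]. *)
pose K := (l + 2) `^ p; have K0 : 0 < K by apply: powR_gt0; lra.
have m0 : 0 < Num.min 1 (e / K) by rewrite lt_min ltr01 divr_gt0.
have := (@cvgrPdist_le _ _ _ _ eventually_filter _ _).1 ul _ m0.
apply: filterS => n; rewrite le_min => /andP[].
rewrite ler_pdivlMr// ler_norml => /andP[un1 un2] unK.
apply: le_trans unK; have [lu|/ltW lu] := leP l (u n).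
  rewrite distrC (distrC l) !ger0_norm ?subr_ge0//; last exact: powR_mono.
  have uB : u n <= l + 1 by lra.
  apply: le_trans (powR_lipschitz p1 l0 lu uB) _.
  by rewrite ler_wpM2l ?subr_ge0// /K (_ : l + 1 + 1 = l + 2)//; lra.
rewrite !ger0_norm ?subr_ge0//; last exact: powR_mono.
have lB : l <= l + 1 by lra.
apply: le_trans (powR_lipschitz p1 (u0 n) lu lB) _.
by rewrite ler_wpM2l ?subr_ge0// /K (_ : l + 1 + 1 = l + 2)//; lra.
Qed.

(** * Characterization of measures and of their convergence by the errors *)

Section characterization.
Context {R : realType} {d : nat} (nm : 'rV[R]_d -> R) (nm_norm : is_norm nm).
Variables (p : R) (p1 : 1 <= p) (N : nat) (b : 'I_N -> 'rV[R]_d) (i0 : 'I_N) (rho : R).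
Hypothesis cell : bounded_cell nm b i0 rho.
Local Notation E := (borelRd R d).
Implicit Types mu nu : probability E R.

Lemma quantization_error_same mu nu (x : 'I_N -> 'rV[R]_d) : same_measure mu nu ->
  quantization_error nm p mu x = quantization_error nm p nu x.
Proof.
move=> mu_nu; rewrite /quantization_error; congr (fine _ `^ _).
by apply: eq_measure_integral => A mA _; exact: mu_nu.
Qed.

(** The p-th powers of the errors converge; so do the bump integrals, as differences of such powers,
    and the moments, as powers of errors at the null grid. *)
Lemma error_cvg_characterizes : error_characterizes_cvg nm p N.
Proof.
move=> mu_ mu fin_ fin err_cvg.
have B := bump_cell_bump nm_norm p1 cell.
have qpow_cvg (x : 'I_N -> 'rV[R]_d) : qpow nm p (mu_ n) x @[n --> \oo] --> qpow nm p mu x.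
  rewrite -(quantization_error_pow nm_norm p1 i0).
  rewrite (_ : (fun n => _) = (fun n => quantization_error nm p (mu_ n) x `^ p)).
    by apply: powR_cvg => // [n|]; exact: quantization_error_ge0.
  by apply/funext => n; rewrite (quantization_error_pow nm_norm p1 i0).
have moment nu : finite_moment nm p nu ->
    (\int[nu]_x (nm x `^ p)%:E = (qpow nm p nu (fun _ : 'I_N => 0))%:E)%E.
  by move=> /moment_fin[M intM M0]; rewrite (qpow_const i0 intM).
apply: (wasserstein_cvg0 nm_norm p1 B (fun n => moment _ (fin_ n)) (moment _ fin)) => //.
move=> r a r0; rewrite (rescale_integral_cell_bump nm_norm p1 cell _ fin r0).
rewrite (_ : (fun n => _) = (fun n => (r `^ p)^-1 *
    (qpow nm p (mu_ n) (shifted r a b) - qpow nm p (mu_ n) (shifted r a (recentred b i0))))).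
  by apply: cvgMl_tmp; apply: cvgB.
by apply/funext => n; rewrite (rescale_integral_cell_bump nm_norm p1 cell).
Qed.

(** Up to r^p, a bump integral is a difference of p-th powers of two errors. Raising both errors by
    C >= 0 cannot decrease it, so [mu] dominates [nu] on all bumps. *)
Lemma same_measure_of_error_ge mu nu (C : R) : finite_moment nm p mu ->
  finite_moment nm p nu -> 0 <= C ->
  (forall x : 'I_N -> 'rV[R]_d,
     quantization_error nm p mu x = quantization_error nm p nu x + C) ->
  same_measure mu nu.
Proof.
move=> finmu finnu C0 errC.
apply: (same_measure_of_bumps nm_norm (bump_cell_bump nm_norm p1 cell)) => r a r0.
rewrite !(rescale_integral_cell_bump nm_norm p1 cell)//.
rewrite ler_pM2l ?invr_gt0 ?powR_gt0//.
rewrite -!(quantization_error_pow nm_norm p1 i0) !errC.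
apply: (powR_convex_shift p1 _ _ C0); first exact: powR_ge0.
rewrite !(quantization_errorE nm_norm p1 i0).
have p0 : 0 <= p^-1 by rewrite invr_ge0 (le_trans ler01).
apply: ge0_ler_powR; [exact: p0|exact: qpow_ge0|exact: qpow_ge0|].
(* Nonnegativity of the bump integral orders the two errors of [nu], as the convexity inequality
   requires. *)
have : 0 <= rescale_integral nu (cell_bump nm p b i0) r a.
  apply/fine_ge0/integral_ge0 => z _; rewrite lee_fin.
  exact: rescale_ge0 (bump_cell_bump nm_norm p1 cell).
rewrite (rescale_integral_cell_bump nm_norm p1 cell a finnu r0).
have rp0 : 0 < (r `^ p)^-1 by rewrite invr_gt0 powR_gt0.
by rewrite (pmulr_rge0 _ rp0) subr_ge0.
Qed.

Lemma error_measure_characterizes : error_characterizes nm p N.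
Proof.
move=> mu nu finmu finnu C errC.
have mu_nu : same_measure mu nu.
  (* A negative C is handled by exchanging the two measures. *)
  have [C0|/ltW C0] := leP 0 C; first exact: same_measure_of_error_ge C0 errC.
  suff nu_mu : same_measure nu mu by move=> A mA; rewrite nu_mu.
  apply: (@same_measure_of_error_ge nu mu (- C)) => //; first by rewrite oppr_ge0.
  by move=> x; rewrite errC addrK.
split=> //; have := errC b; rewrite (quantization_error_same _ mu_nu).
by move/eqP; rewrite addrC -subr_eq subrr => /eqP.
Qed.

End characterization.

(** * Comparison of the quantization and Wasserstein distances *)

Section wasserstein.
Context {R : realType} {d : nat} (nm : 'rV[R]_d -> R) (nm_norm : is_norm nm).
Variables (p : R) (p1 : 1 <= p).
Local Notation E := (borelRd R d).
Implicit Types mu nu : probability E R.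

Let p0 : 0 < p. Proof. exact: lt_le_trans p1. Qed.

(** The coupling with an empty family of parts, where the rest is everything, has finite cost. *)
Lemma wasserstein_fin mu nu : finite_moment nm p mu -> finite_moment nm p nu ->
  wasserstein nm p mu nu \is a fin_num.
Proof.
move=> /moment_fin[M intM M0] /moment_fin[M' intM' M'0].
pose t (i : 'I_0) : R := 0; pose a (i : 'I_0) : 'rV[R]_d := 0.
have parts (m : probability E R) : partial_parts nm a 0 0 t m (fun _ _ => 0).
  by split=> // [x|[]//|[]//]; rewrite big_ord0.
have [pi pi_coupling pi_cost] := coupling_of_partial_parts nm_norm p1 ltr01 (lexx 0)
  (parts mu) (parts nu) intM intM'.
set X := (X in (_ <= X%:E)%E) in pi_cost.
rewrite ge0_fin_numE ?poweR_ge0//.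
apply: (@le_lt_trans _ _ (`|X| `^ p^-1)%:E); last by rewrite ltry.
apply: (wasserstein_le p1 (powR_ge0 _ _) pi_coupling).
by rewrite (le_trans pi_cost)// powRVK// lee_fin ler_norm.
Qed.

(** Swapping coordinates carries couplings of [nu] and [mu] to couplings of [mu] and [nu] at the
    same cost. *)
Lemma wasserstein_sym_le mu nu : (wasserstein nm p mu nu <= wasserstein nm p nu mu)%E.
Proof.
have cost_ge0 (m m' : probability E R) : (0 <= ereal_inf
    [set \int[pi]_z (nm ((z.1 : 'rV[R]_d) - (z.2 : 'rV[R]_d)) `^ p)%:E | pi in coupling m m'])%E.
  apply: le_ereal_inf_tmp => _ [pi _ <-].
  by apply: integral_ge0 => z _; rewrite lee_fin powR_ge0.
apply: gt0_ler_poweR; rewrite ?in_itv/= ?leey ?andbT ?cost_ge0 ?invr_ge0 ?(ltW p0)//.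
apply: le_ereal_inf_tmp => _ [pi pi_coupling <-]; apply: ge_ereal_inf.
pose swap (z : E * E) : E * E := (z.2, z.1).
have mswap : measurable_fun setT swap.
  by apply: measurable_fun_pair; [exact: measurable_snd|exact: measurable_fst].
pose swap_mixin := isMeasurableFun.Build _ _ _ _ _ mswap.
pose swap_mfun : {mfun (E * E)%type >-> (E * E)%type} := HB.pack swap swap_mixin.
exists (\int[pi]_z (nm ((z.1 : 'rV[R]_d) - (z.2 : 'rV[R]_d)) `^ p)%:E)%E => //.
exists (distribution pi swap_mfun).
  by move=> A mA; have [fstA sndA] := pi_coupling A mA; split; [exact: sndA|exact: fstA].
have mcost : measurable_fun [set: E * E]
    (fun z : E * E => (nm ((z.1 : 'rV[R]_d) - (z.2 : 'rV[R]_d)) `^ p)%:E).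
  apply/measurable_EFinP.
  exact: measurableT_comp (measurable_powR p) (norm_diff_measurable nm_norm).
have int_swap := ge0_integral_distribution (P := pi) swap_mfun mcost (fun z => powR_ge0 _ _).
apply: (etrans int_swap).
by apply: eq_integral => z _; rewrite /= (norm_sym nm_norm).
Qed.

Lemma wasserstein_sym mu nu : wasserstein nm p mu nu = wasserstein nm p nu mu.
Proof. by apply/le_anti; rewrite !wasserstein_sym_le. Qed.

Section quantization.
Variables (N : nat) (i0 : 'I_N).
Implicit Types x : 'I_N -> 'rV[R]_d.

(** Change of variables along [P], to be used for the two projections of a coupling. *)
Lemma qpow_coupling (pi : probability (E * E)%type R) x (P : E * E -> E)
    (m : probability E R) :
  measurable_fun setT P -> (forall A, measurable A -> pi (P @^-1` A) = m A) ->
  finite_moment nm p m ->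
  (\int[pi]_z (nearest nm x (P z) `^ p)%:E =
    (qpow nm p m x)%:E)%E.
Proof.
move=> mP pi_m fin; rewrite -(qpowE nm_norm p1 i0 x fin).
have mnear := nearest_pow_measurable nm_norm p i0 x.
pose P_mixin := isMeasurableFun.Build _ _ _ _ _ mP.
pose P_mfun : {mfun (E * E)%type >-> E} := HB.pack P P_mixin.
rewrite [RHS](_ : _ = \int[distribution pi P_mfun]_z (nearest nm x z `^ p)%:E)%E.
  apply/esym/(@ge0_integral_distribution _ _ _ _ _ pi P_mfun); first exact/measurable_EFinP.
  by move=> z; rewrite lee_fin powR_ge0.
by apply: eq_measure_integral => A mA _; exact/esym/pi_m.
Qed.

Lemma Lnorm_powR (pi : probability (E * E)%type R) (f : E * E -> R) :
  (forall z, 0 <= f z) ->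
  ('N[pi]_p%:E[(EFin \o f)%R] = (\int[pi]_z (f z `^ p)%:E) `^ p^-1)%E.
Proof.
move=> f0; rewrite unlock; apply: (congr1 (fun c => c `^ p^-1)%E).
by apply: eq_integral => z _; rewrite gee0_abs ?lee_fin// poweR_EFin.
Qed.

(** The errors are the L^p(pi) norms of the distance to the grid at each coordinate. That distance
    is 1-Lipschitz, so Minkowski's inequality bounds their difference by the L^p norm of |z.1 -
    z.2|. *)
Lemma quantization_error_coupling mu nu pi x : coupling mu nu pi ->
  finite_moment nm p mu -> finite_moment nm p nu ->
  ((`|quantization_error nm p mu x - quantization_error nm p nu x| `^ p)%:E <=
   \int[pi]_z (nm ((z.1 : 'rV[R]_d) - (z.2 : 'rV[R]_d)) `^ p)%:E)%E.
Proof.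
move=> pi_coupling finmu finnu.
pose g (z : E * E) : R := nm ((z.1 : 'rV[R]_d) - (z.2 : 'rV[R]_d)).
have g0 z : 0 <= g z by exact: norm_ge0.
have mg : measurable_fun setT g by exact: norm_diff_measurable.
have mf : measurable_fun setT (fun z : E * E => nearest nm x z.1).
  exact: measurableT_comp (nearest_measurable nm_norm i0 x) measurable_fst.
have ms : measurable_fun setT (fun z : E * E => nearest nm x z.2).
  exact: measurableT_comp (nearest_measurable nm_norm i0 x) measurable_snd.
have near0 z : 0 <= nearest nm x z by exact: nearest_ge0.
have Nerr (P : E * E -> E) (m : probability E R) : measurable_fun setT P ->
    (forall A, measurable A -> pi (P @^-1` A) = m A) -> finite_moment nm p m ->
    ('N[pi]_p%:E[(EFin \o (fun z => nearest nm x (P z)))%R] =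
      (quantization_error nm p m x)%:E)%E.
  move=> mP pi_m fin; rewrite Lnorm_powR//.
  rewrite (qpow_coupling x mP pi_m fin) poweR_EFin.
  by rewrite (quantization_errorE nm_norm p1 i0).
have Nfst := Nerr fst mu measurable_fst (fun A mA => (pi_coupling A mA).1) finmu.
have Nsnd := Nerr snd nu measurable_snd (fun A mA => (pi_coupling A mA).2) finnu.
have Ng := Lnorm_powR pi g0.
have le_N (u v : E * E -> R) : measurable_fun setT u -> measurable_fun setT v ->
    (forall z, 0 <= u z) -> (forall z, 0 <= v z) -> (forall z, u z <= v z + g z) ->
    ('N[pi]_p%:E[(EFin \o u)%R] <= 'N[pi]_p%:E[(EFin \o v)%R] + 'N[pi]_p%:E[(EFin \o g)%R])%E.
  move=> mu_ mv u0 v0 uvg; apply: (@le_trans _ _ ('N[pi]_p%:E[(EFin \o (v \+ g))%R]))%E.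
    have vg0 z : 0 <= (v \+ g) z by rewrite /= addr_ge0.
    rewrite !Lnorm_powR//.
    have int_ge0 (w : E * E -> R) : (0 <= \int[pi]_z (w z `^ p)%:E)%E.
      by apply: integral_ge0 => z _; rewrite lee_fin powR_ge0.
    apply: gt0_ler_poweR; rewrite ?in_itv/= ?leey ?andbT ?int_ge0 ?invr_ge0 ?(ltW p0)//.
    have mpow w : measurable_fun setT w -> measurable_fun setT (fun z : E * E => (w z `^ p)%:E).
      by move=> mw; apply/measurable_EFinP; exact: measurableT_comp (measurable_powR p) mw.
    apply: ge0_le_integral => //.
    - by move=> z _; rewrite lee_fin powR_ge0.
    - exact: mpow.
    - by apply: mpow; exact: measurable_funD.
    - by move=> z _; rewrite lee_fin; apply: powR_mono => //; exact: uvg.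
  exact: minkowski_EFin.
have near_le y z : nearest nm x y <= nearest nm x z + nm (y - z).
  by have := nearest_lipschitz nm_norm i0 x y z; rewrite ler_norml => /andP[_]; lra.
have le1 := le_N _ _ mf ms (fun z => near0 _) (fun z => near0 _) (fun z => near_le z.1 z.2).
have le2 : ('N[pi]_p%:E[(EFin \o (fun z => nearest nm x z.2))%R] <=
    'N[pi]_p%:E[(EFin \o (fun z => nearest nm x z.1))%R] + 'N[pi]_p%:E[(EFin \o g)%R])%E.
  apply: le_N => // z; rewrite /g (norm_sym nm_norm); exact: near_le.
move: le1 le2; rewrite Nfst Nsnd Ng.
(* An infinite cost is trivial; otherwise everything reduces to real numbers. *)
have [->|cfin] := eqVneq (\int[pi]_z (nm ((z.1 : 'rV[R]_d) - (z.2 : 'rV[R]_d)) `^ p)%:E)%E +oo%E.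
  by rewrite leey.
have c0 : (0 <= \int[pi]_z (g z `^ p)%:E)%E.
  by apply: integral_ge0 => z _; rewrite lee_fin powR_ge0.
have : (\int[pi]_z (g z `^ p)%:E)%E \is a fin_num by rewrite ge0_fin_numE// ltey.
rewrite -/g; case: (\int[pi]_z (g z `^ p)%:E)%E c0 => [c| |]// c0 _.
rewrite lee_fin in c0; rewrite poweR_EFin -!EFinD !lee_fin => le1 le2.
rewrite -[leRHS](powRVK p1 c0); apply: powR_mono => //.
move: (quantization_error _ _ mu x) (quantization_error _ _ nu x) le1 le2 => u v le1 le2.
by rewrite ler_norml; apply/andP; split; lra.
Qed.

Lemma quantization_dist_le mu nu : finite_moment nm p mu -> finite_moment nm p nu ->
  (quantization_dist nm p N mu nu <= wasserstein nm p mu nu)%E.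
Proof.
move=> finmu finnu; apply: ge_ereal_sup => _ [x _ <-].
rewrite -(powRK p1 (normr_ge0 _)) -poweR_EFin.
have le_inf : ((`|quantization_error nm p mu x - quantization_error nm p nu x| `^ p)%:E <=
    ereal_inf [set \int[pi]_z (nm ((z.1 : 'rV[R]_d) - (z.2 : 'rV[R]_d)) `^ p)%:E
              | pi in coupling mu nu])%E.
  apply: le_ereal_inf_tmp => _ [pi pi_coupling <-].
  exact: quantization_error_coupling.
apply: gt0_ler_poweR => //; rewrite ?in_itv/= ?leey ?andbT ?lee_fin ?powR_ge0//.
  by rewrite invr_ge0 ltW.
by apply: le_trans le_inf; rewrite lee_fin powR_ge0.
Qed.

Lemma quantization_dist_ge mu nu x :
  (`|quantization_error nm p mu x - quantization_error nm p nu x|%:E <=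
   quantization_dist nm p N mu nu)%E.
Proof. by apply: ereal_sup_ubound; exists x. Qed.

Lemma quantization_dist_fin mu nu : finite_moment nm p mu -> finite_moment nm p nu ->
  quantization_dist nm p N mu nu \is a fin_num.
Proof.
move=> finmu finnu; rewrite ge0_fin_numE; last first.
  by apply: le_trans (quantization_dist_ge mu nu (fun=> 0)); rewrite lee_fin.
apply: le_lt_trans (quantization_dist_le finmu finnu) _.
by rewrite ltey_eq wasserstein_fin.
Qed.

Lemma quantization_is_distance : error_characterizes nm p N ->
  is_distance (finite_moment nm p) same_measure (quantization_dist nm p N).
Proof.
move=> charN; split.
- exact: quantization_dist_fin.
- move=> mu nu _ _; apply: le_trans (quantization_dist_ge mu nu (fun=> 0)).
  by rewrite lee_fin.
- move=> mu nu finmu finnu; split=> [Q0|mu_nu].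
    suff [] : same_measure mu nu /\ 0 = 0 :> R by [].
    apply: charN => // x; have := quantization_dist_ge mu nu x.
    by rewrite Q0 lee_fin normr_le0 subr_eq0 addr0 => /eqP.
  apply/eqP; rewrite eq_le; apply/andP; split; last first.
    by apply: le_trans (quantization_dist_ge mu nu (fun=> 0)); rewrite lee_fin.
  apply: ge_ereal_sup => _ [x _ <-].
  by rewrite (quantization_error_same nm p x mu_nu) subrr normr0.
- move=> mu nu _ _; apply: (congr1 (@ereal_sup R)); apply: eq_imagel => x _.
  exact: (congr1 EFin (distrC _ _)).
- move=> m1 m2 m3 _ _ _; apply: ge_ereal_sup => _ [x _ <-].
  apply: le_trans (leeD (quantization_dist_ge m1 m2 x) (quantization_dist_ge m2 m3 x)).
  by rewrite -EFinD lee_fin ler_distD.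
Qed.

(** Sequences suffice: were U not open at [mu], points outside U at quantization distance below 1 /
    (n + 1) would converge to [mu] in the Wasserstein distance. *)
Lemma quantization_topology : error_characterizes_cvg nm p N ->
  topologically_equivalent (finite_moment nm p)
    (quantization_dist nm p N) (wasserstein nm p).
Proof.
move=> cvgN; apply/seteqP; split=> U [Ufin Uopen]; split=> // mu Umu.
  have [e e0 eU] := Uopen _ Umu; exists e => // nu finnu W_e; apply: eU => //.
  by apply: le_lt_trans W_e; apply: quantization_dist_le => //; exact: Ufin.
apply: contrapT => noe; have [e e0 eU] := Uopen _ Umu; have finmu := Ufin _ Umu.
have seq n : exists nu, [/\ finite_moment nm p nu,
    (quantization_dist nm p N mu nu < n.+1%:R^-1%:E)%E & ~ U nu].
  apply: contrapT => nonu; apply: noe; exists n.+1%:R^-1; first by rewrite invr_gt0.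
  by move=> nu finnu Qnu; apply: contrapT => nU; apply: nonu; exists nu.
have [nu_ nu_P] := choice seq.
have : wasserstein nm p (nu_ n) mu @[n --> \oo] --> 0%E.
  apply: cvgN => // [n|x]; first by have [] := nu_P n.
  apply/(@cvgrPdist_le _ _ _ _ eventually_filter) => e' e'0.
  have := (@cvgr_lt _ _ _ eventually_filter _ _ (@cvg_harmonic R)) _ e'0.
  apply: filterS => n /= ne'; have [_ Qn _] := nu_P n.
  rewrite -lee_fin (le_trans (quantization_dist_ge mu (nu_ n) x))//.
  by rewrite ltW// (lt_trans Qn)// lte_fin.
move=> /fine_cvgP[Wfin] /(@cvgr_lt _ _ _ eventually_filter)/(_ _ e0) Wlt.
have [n [nfin ne]] := filter_ex (filterI Wfin Wlt).
have [finnu _ nU] := nu_P n; apply/nU/eU => //.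
(* Convergence concerns the distance from the sequence to [mu], open sets the distance from [mu]:
   symmetry reconciles them. *)
by rewrite wasserstein_sym -(fineK nfin) lte_fin.
Qed.

End quantization.

End wasserstein.

(** * Bounds on the characterizing number and equivalence of the topologies *)

Theorem corollary2p2 (R : realType) (d : nat) (d1 : (1 <= d)%N)
    (p : R) (p1 : 1 <= p) (nm : 'rV[R]_d -> R) (nm_norm : is_norm nm) :
  exists2 c : nat, is_covering_number nm c &
    (exists2 Ndp : nat, is_characterizing_number nm p Ndp &
       (Ndp <= c + 1)%N /\ (euclidean nm -> (Ndp <= d + 2)%N)) /\
    (forall N : nat,
       (c + 1 <= N)%N \/ (euclidean nm /\ (d + 2 <= N)%N) ->
       is_distance (finite_moment nm p) same_measure
         (quantization_dist nm p N) /\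
       topologically_equivalent (finite_moment nm p)
         (quantization_dist nm p N) (wasserstein nm p)).
Proof.
have [c cP] := covering_number_exists nm_norm; exists c; first exact: cP.
(* Either lower bound on N yields a bounded cell, which is all that the sequel needs of N. *)
have cell N : (c + 1 <= N)%N \/ (euclidean nm /\ (d + 2 <= N)%N) ->
    exists (b : 'I_N -> 'rV[R]_d) i0 rho, bounded_cell nm b i0 rho.
  case=> [cN|[eucl dN]].
    by have [b [i0 bi0]] := covered_bounded_cell nm_norm d1 cP.1 cN; exists b, i0, 1.
  by have [b [i0 [rho [_ bi0]]]] := euclidean_bounded_cell nm_norm d1 eucl dN; exists b, i0, rho.
have char N : (c + 1 <= N)%N \/ (euclidean nm /\ (d + 2 <= N)%N) ->
    [/\ (1 <= N)%N, error_characterizes nm p N & error_characterizes_cvg nm p N].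
  move=> /cell[b [i0 [rho bi0]]]; split; first exact: leq_ltn_trans (ltn_ord i0).
    exact: error_measure_characterizes bi0.
  exact: error_cvg_characterizes bi0.
split; last first.
  move=> N HN; have [_ charN cvgN] := char N HN; have [_ [i0 _]] := cell N HN.
  by split; [exact: quantization_is_distance i0 charN|exact: quantization_topology i0 cvgN].
(* The characterizing number is the least element of a set containing every N allowed by [char];
   both upper bounds follow by minimality. *)
pose Q N := `[< [/\ (1 <= N)%N, error_characterizes nm p N & error_characterizes_cvg nm p N] >].
have exQ : exists N, Q N by exists (c + 1)%N; apply/asboolP/char; left.
case: (ex_minnP exQ) => Ndp /asboolP QN minN; exists Ndp.
  by split=> // m Qm; apply: minN; apply/asboolP.
split; first by apply: minN; apply/asboolP/char; left.
by move=> eucl; apply: minN; apply/asboolP/char; right.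
Qed.
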